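(* There exists a $\Delta^0_2$ partition $A_0\cup A_1=2^{<\omega}$ with the following property. For every (not necessarily computable) partition $B_0\cup B_1=\omega$, there is an infinite set $H$ with $H\subseteq B_0$ or $H\subseteq B_1$ such that $H$ does not compute any set $S\subseteq 2^{<\omega}$ with $S\cong 2^{<\omega}$ and ($S\subseteq A_0$ or $S\subseteq A_1$).
   Context: A set $S\subseteq 2^{<\omega}$ is order isomorphic to $2^{<\omega}$ (written $S\cong 2^{<\omega}$) if there is a bijection $g:2^{<\omega}\to S$ such that, for all $\sigma,\tau\in 2^{<\omega}$, $\sigma\preceq\tau$ if and only if $g(\sigma)\preceq g(\tau)$. Here $\preceq$ is the prefix relation on binary strings. *)

(* Defs.v *)
From mathcomp Require Import all_boot.
Set Implicit Arguments. Unset Strict Implicit. Unset Printing Implicit Defensive.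

(* Oracle partial recursive functions (mu-recursive functions with an      *)
(* oracle X : nat -> bool).  This is the standard model of relative        *)
(* computability; Y <=_T X iff the characteristic function of Y is a total *)
(* X-partial-recursive function.                                           *)
Inductive prf : Type :=
| PZero
| PSucc
| PProj of nat
| POracle
| PComp of prf & list prf
| PPrec of prf & prf
| PMu of prf.

Inductive peval (X : nat -> bool) : prf -> list nat -> nat -> Prop :=
| ev_zero args : peval X PZero args 0
| ev_succ args : peval X PSucc args (nth 0 args 0).+1
| ev_proj i args : peval X (PProj i) args (nth 0 args i)
| ev_oracle args : peval X POracle args (nat_of_bool (X (nth 0 args 0)))
| ev_comp f gs args ys r :
    pevals X gs args ys -> peval X f ys r -> peval X (PComp f gs) args r
| ev_prec0 f g rest r :
    peval X f rest r -> peval X (PPrec f g) (0 :: rest) r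
| ev_precS f g n rest r r' :
    peval X (PPrec f g) (n :: rest) r ->
    peval X g (n :: r :: rest) r' ->
    peval X (PPrec f g) (n.+1 :: rest) r'
| ev_mu f args n :
    peval X f (n :: args) 0 ->
    (forall m, m < n -> exists k, peval X f (m :: args) k.+1) ->
    peval X (PMu f) args n
with pevals (X : nat -> bool) : list prf -> list nat -> list nat -> Prop :=
| evs_nil args : pevals X nil args nil
| evs_cons g gs args y ys :
    peval X g args y -> pevals X gs args ys -> pevals X (g :: gs) args (y :: ys).

Definition empty_oracle : nat -> bool := fun _ => false.

(* Canonical computable bijection between binary strings and naturals. *)
Fixpoint code (s : seq bool) : nat :=
  match s with
  | [::] => 0
  | b :: s' => 2 * code s' + (if b then 2 else 1)
  end.

Definition computes (H : nat -> bool) (S : seq bool -> bool) : Prop :=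
  exists e : prf, forall s : seq bool, peval H e [:: code s] (nat_of_bool (S s)).

Definition computable_rel3 (R : nat -> nat -> nat -> bool) : Prop :=
  exists e : prf, forall a b c, peval empty_oracle e [:: a; b; c] (nat_of_bool (R a b c)).

Definition Sigma02 (A : seq bool -> bool) : Prop :=
  exists R, computable_rel3 R /\
    forall s, A s <-> exists x, forall y, R (code s) x y.
Definition Pi02 (A : seq bool -> bool) : Prop :=
  exists R, computable_rel3 R /\
    forall s, A s <-> forall x, exists y, R (code s) x y.
Definition Delta02 (A : seq bool -> bool) : Prop := Sigma02 A /\ Pi02 A.

Definition iso_full_tree (S : seq bool -> bool) : Prop :=
  exists g : seq bool -> seq bool,
    [/\ forall s, S (g s),
        forall t, S t -> exists s, g s = t,
        injective g &
        forall s t, prefix s t <-> prefix (g s) (g t)].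

Definition infinite_set (H : nat -> bool) : Prop :=
  forall n, exists m, n <= m /\ H m.

(* Main.v *)
Require Import Defs.
From mathcomp Require Import all_boot boolp zify.

Set Implicit Arguments. Unset Strict Implicit. Unset Printing Implicit Defensive.

(** The codes of strings are cut into consecutive blocks [a, a'), where a'
exceeds the halting time on input a of every program with code at most a that
halts on a; so every computable h satisfies h(a) < a' for some block of each
kind. On a block of kind (j, b) the colour of a string is its j-th bit xor b.
The blocks, hence the colouring, are limits of a computable process.

Given B, the set H is built by forcing. A condition fixes an initial segment
of a subset of B_0 and one of B_1, and a downward closed effectively closed
class of reservoirs containing one whose gaps are computably bounded. Suppose
functional i (i = 0, 1), aiming at colour a_i, already outputs a string of the
solution that has bit β_i at position j, with β_0 xor a_0 = β_1 xor a_1. By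
compactness there are two cases. Either some n and some splitting of a reservoir
into two sides leave each functional i without outputs of code above n having
bit β_i at position j; then one of the sides has computably bounded gaps on
some subclass, and its functional cannot output a tree. Or for every n there is a
computable bound on the search for such an output, uniformly over all
splittings; then a block of the right kind outgrows it, the splitting by B
yields an output, and it has the wrong colour. *)

(** * Coding of programs and computations *)

Section PrfInd.
Variable P : prf -> Prop.
Hypothesis PZ : P PZero.
Hypothesis PS : P PSucc.
Hypothesis PP : forall i, P (PProj i).
Hypothesis PO : P POracle.
Hypothesis PC : forall f gs, P f -> (forall i, i < size gs -> P (nth PZero gs i)) ->
  P (PComp f gs).
Hypothesis PR : forall f g, P f -> P g -> P (PPrec f g).
Hypothesis PM : forall f, P f -> P (PMu f).

(** The generated principle for [prf] gives no hypothesis for the programs listed inside [PComp];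
    the inner fixpoint supplies one for each index. *)
Fixpoint prf_nested_ind (e : prf) : P e :=
  match e with
  | PZero => PZ
  | PSucc => PS
  | PProj i => PP i
  | POracle => PO
  | PComp f gs =>
      PC (prf_nested_ind f)
        ((fix all_nth (l : seq prf) : forall i, i < size l -> P (nth PZero l i) :=
            match l with
            | [::] => fun i (lt : i < 0) => False_ind _ (notF lt)
            | g :: l' => fun i =>
                match i with
                | 0 => fun _ => prf_nested_ind g
                | i'.+1 => fun lt => all_nth l' i' lt
                end
            end) gs)
  | PPrec f g => PR (prf_nested_ind f) (prf_nested_ind g)
  | PMu f => PM (prf_nested_ind f)
  end.
End PrfInd.

(** Induction is on the program, not on the mutual derivations; [PPrec] needs a second induction, on
    its recursion argument. *)
Lemma peval_det X e a r r' : peval X e a r -> peval X e a r' -> r = r'.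
Proof.
move: e a r r'; apply: prf_nested_ind => [|||||f g IHf IHg|f IHf].
- by move=> a r r' H H'; inversion H; inversion H'.
- by move=> a r r' H H'; inversion H; inversion H'.
- by move=> i a r r' H H'; inversion H; inversion H'.
- by move=> a r r' H H'; inversion H; inversion H'.
- move=> f gs IHf IHgs a r r' H H'.
  inversion H as [| | | |f1 gs1 a1 ys r1 Hs Hf| | |]; subst.
  inversion H' as [| | | |f1 gs1 a1 ys' r1 Hs' Hf'| | |]; subst.
  suff E : ys = ys' by subst; apply: IHf Hf Hf'.
  elim: gs IHgs ys ys' Hs Hs' {Hf Hf' H H'} => [|g gs IH] IHgs ys ys' Hs Hs'.
    by inversion Hs; inversion Hs'.
  inversion Hs as [|g1 gs1 a1 y zs Hg Hgs]; subst.
  inversion Hs' as [|g1 gs1 a1 y' zs' Hg' Hgs']; subst.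
  congr (_ :: _); first exact: (IHgs 0 isT) Hg Hg'.
  by apply: IH Hgs Hgs' => i; apply: (IHgs i.+1).
- case=> [|n rest] r r' H H'; first by inversion H.
  elim: n r r' H H' => [|n IHn] r r' H H'.
    inversion H; subst; inversion H'; subst; exact: IHf H4 H5.
  inversion H as [| | | | | |f1 g1 n1 rest1 q r1 Hq Hg|]; subst.
  inversion H' as [| | | | | |f1 g1 n1 rest1 q' r1 Hq' Hg'|]; subst.
  by move: (IHn _ _ Hq Hq') => E; subst; apply: IHg Hg Hg'.
- move=> a r r' H H'.
  inversion H as [| | | | | | |f1 a1 n1 H0 Hlt]; subst.
  inversion H' as [| | | | | | |f1 a1 n1 H0' Hlt']; subst.
  case: (ltngtP r r') => // lt.
    by have [k Hk] := Hlt' _ lt; have := IHf _ _ _ H0 Hk.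
  by have [k Hk] := Hlt _ lt; have := IHf _ _ _ H0' Hk.
Qed.

(* Injective but not surjective, which suffices for coding derivations. *)
Definition npair x y := (x + y) * (x + y) + x.

(** The sum [x + y] is the integer square root of the code, because [x <= x + y]. *)
Lemma npair_inj x y x' y' : npair x y = npair x' y' -> x = x' /\ y = y'.
Proof. rewrite /npair => E. have : x + y = x' + y' by nia. nia. Qed.

Definition cons_code x l := (npair x l).+1.

Lemma cons_code_inj x y x' y' : cons_code x y = cons_code x' y' -> x = x' /\ y = y'.
Proof. by case=> /npair_inj. Qed.

Fixpoint list_code (l : seq nat) := if l is x :: l' then cons_code x (list_code l') else 0.

(** [bit y] is the finite set with canonical index [y]: a number can thus serve as an oracle or as a
    set of judgements. *)
Definition bit y x := odd (iter x half y).

Lemma bitS y x : bit y x.+1 = bit y./2 x.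
Proof. by rewrite /bit iterSr. Qed.

Lemma bit_lt y x : bit y x -> x < y.
Proof.
elim: x y => [|x IH] y; first by case: y.
rewrite bitS => /IH; lia.
Qed.

Lemma bit0 x : bit 0 x = false.
Proof. by apply/negP => /bit_lt. Qed.

Fixpoint bitmask (Y : nat -> bool) u :=
  if u is u'.+1 then Y 0 + (bitmask (fun x => Y x.+1) u').*2 else 0.

Lemma bit_bitmask Y u x : bit (bitmask Y u) x = (x < u) && Y x.
Proof.
elim: u Y x => [|u IH] Y x; first by rewrite bit0.
case: x => [|x]; first by rewrite /bit /= oddD odd_double oddb addbF.
by rewrite bitS /= half_bit_double IH.
Qed.

Lemma bitmask_lt Y u : bitmask Y u < 2 ^ u.
Proof.
elim: u Y => [|u IH] Y //=; have := IH (fun x => Y x.+1); rewrite expnS.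
by case: (Y 0) => /=; lia.
Qed.

(** Boolean bounded quantifiers, kept as named constants so that computability can be proved by
    matching on the shape of a formula. *)
Definition allb n (p : nat -> bool) := all p (iota 0 n).
Definition exb n (p : nat -> bool) := has p (iota 0 n).

Lemma allbP n (p : nat -> bool) : reflect (forall x, x < n -> p x) (allb n p).
Proof.
apply: (iffP allP) => H x; first by move=> lt; apply: H; rewrite mem_iota.
by rewrite mem_iota => /H.
Qed.

Lemma exbP n (p : nat -> bool) : reflect (exists2 x, x < n & p x) (exb n p).
Proof.
apply: (iffP hasP) => -[x lt px]; exists x => //; first by rewrite mem_iota in lt.
by rewrite mem_iota.
Qed.

Lemma allbS n (p : nat -> bool) : allb n.+1 p = allb n p && p n.
Proof. by rewrite /allb -addn1 iotaD all_cat /= andbT. Qed.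

Lemma exb_negb n (p : nat -> bool) : exb n p = ~~ allb n (fun x => ~~ p x).
Proof. by rewrite /exb /allb all_predC negbK. Qed.

Fixpoint prf_code (e : prf) : nat :=
  match e with
  | PZero => npair 0 0
  | PSucc => npair 1 0
  | PProj i => npair 2 i
  | POracle => npair 3 0
  | PComp f gs =>
      npair 4 (npair (prf_code f)
        ((fix prfs_code (l : seq prf) :=
            if l is g :: l' then cons_code (prf_code g) (prfs_code l') else 0) gs))
  | PPrec f g => npair 5 (npair (prf_code f) (prf_code g))
  | PMu f => npair 6 (prf_code f)
  end.

Definition prfs_code (gs : seq prf) := list_code (map prf_code gs).

Lemma prf_code_comp f gs : prf_code (PComp f gs) = npair 4 (npair (prf_code f) (prfs_code gs)).
Proof.
by rewrite /=; congr (npair _ (npair _ _)); elim: gs => //= g gs ->.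
Qed.

Lemma prf_code_inj : injective prf_code.
Proof.
have inj0 x y x' y' : npair x y = npair x' y' -> (x = x') * (y = y').
  by case/npair_inj.
apply: prf_nested_ind => [||i||f gs IHf IHgs|f g IHf IHg|f IHf] e';
  case: e' => [||i'||f' gs'|f' g'|f'] //; rewrite ?prf_code_comp;
  try by move=> /inj0[].
- by move=> /inj0[_ ->].
- move=> /inj0[_ /inj0[/IHf -> E]]; congr PComp.
  elim: gs gs' IHgs E => [|g gs IH] [|g' gs'] //= IHgs /cons_code_inj[E1 E2].
  congr (_ :: _); first exact: (IHgs 0 isT).
  by apply: IH E2 => i; apply: (IHgs i.+1).
- by move=> /inj0[_ /inj0[/IHf -> /IHg ->]].
- by move=> /inj0[_ /IHf ->].
Qed.

(** Three kinds of judgements on codes: program [e] on arguments [a] returns [r]; the program list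
    [gs] returns [ys]; entry [i] of the list [a] is [r], with default 0. *)
Definition evJ e a r := npair 0 (npair e (npair a r)).
Definition evsJ gs a ys := npair 1 (npair gs (npair a ys)).
Definition nthJ i a r := npair 2 (npair i (npair a r)).

Definition just_nth u (M : nat -> bool) i a r :=
  [|| (a == 0) && (r == 0),
      (i == 0) && exb u (fun t => a == cons_code r t)
    | exb u (fun i' => exb u (fun h => exb u (fun t =>
        [&& i == i'.+1, a == cons_code h t & M (nthJ i' t r)])))].

Definition just_evs u (M : nat -> bool) gs a ys :=
  (gs == 0) && (ys == 0) ||
  exb u (fun g => exb u (fun gs' => exb u (fun y => exb u (fun ys' =>
    [&& gs == cons_code g gs', ys == cons_code y ys',
        M (evJ g a y) & M (evsJ gs' a ys')])))).

Definition just_ev u (M Y : nat -> bool) e a r :=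
  [|| (e == npair 0 0) && (r == 0),
      (e == npair 1 0) && exb u (fun q => (r == q.+1) && M (nthJ 0 a q)),
      exb u (fun i => (e == npair 2 i) && M (nthJ i a r)),
      (e == npair 3 0) && exb u (fun q => M (nthJ 0 a q) && (r == nat_of_bool (Y q))),
      exb u (fun f => exb u (fun gs => exb u (fun ys =>
        [&& e == npair 4 (npair f gs), M (evsJ gs a ys) & M (evJ f ys r)]))),
      exb u (fun f => exb u (fun g => exb u (fun rest =>
        [&& e == npair 5 (npair f g), a == cons_code 0 rest & M (evJ f rest r)]))),
      exb u (fun f => exb u (fun g => exb u (fun rest => exb u (fun n => exb u (fun q =>
        [&& e == npair 5 (npair f g), a == cons_code n.+1 rest,
            M (evJ e (cons_code n rest) q) &
            M (evJ g (cons_code n (cons_code q rest)) r)])))))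
    | exb u (fun f =>
        [&& e == npair 6 f, M (evJ f (cons_code r a) 0) &
            allb r (fun m => exb u (fun k => M (evJ f (cons_code m a) k.+1)))])].

Definition just u (M Y : nat -> bool) j :=
  exb u (fun x => exb u (fun a => exb u (fun r =>
    [|| (j == nthJ x a r) && just_nth u M x a r,
        (j == evsJ x a r) && just_evs u M x a r
      | (j == evJ x a r) && just_ev u M Y x a r]))).

(* The bitmask d is a finite set of judgements, each justified by members of d.
   No ordering is needed: premises concern a smaller program, or the same one at
   a smaller recursion argument. The bound u also limits the oracle queries. *)
Definition run u (Y : nat -> bool) e s r :=
  exb u (fun d => allb d (fun j => bit d j ==> just u (bit d) Y j) &&
                  bit d (evJ e (cons_code s 0) r)).

Lemma exb_mono u u' (p q : nat -> bool) :
  u <= u' -> (forall x, x < u -> p x -> q x) -> exb u p -> exb u' q.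
Proof. by move=> le pq /exbP[x lt px]; apply/exbP; exists x; [lia | apply: pq]. Qed.

Lemma allb_mono n (p q : nat -> bool) :
  (forall x, x < n -> p x -> q x) -> allb n p -> allb n q.
Proof. by move=> pq /allbP H; apply/allbP => x lt; apply: pq (H x lt). Qed.

Lemma orb_mono (a b c d : bool) : (a -> c) -> (b -> d) -> a || b -> c || d.
Proof. by case: a; case: b; case: c; case: d => // H H'; move: (H isT) (H' isT). Qed.

Lemma andb_mono (a b c d : bool) : (a -> c) -> (b -> d) -> a && b -> c && d.
Proof. by move=> H H' /andP[/H -> /H' ->]. Qed.

Ltac mono := repeat first
  [ exact: id | solve [auto] | apply: orb_mono | apply: andb_mono | apply: allb_mono => ? ?
  | apply: exb_mono => // ? ? ].

(** [M] occurs only positively, existential searches are bounded by [u], and the oracle is queried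
    only below [u]. *)
Lemma just_mono u u' (M M' Y Y' : nat -> bool) j :
  u <= u' -> (forall x, M x -> M' x) -> (forall x, x < u -> Y x = Y' x) ->
  just u M Y j -> just u' M' Y' j.
Proof.
move=> le MM YY; rewrite /just /just_nth /just_evs /just_ev; mono.
by rewrite YY // => /andP[/MM -> ->].
Qed.

Lemma run_mono u u' (Y Y' : nat -> bool) e s r :
  u <= u' -> (forall x, x < u -> Y x = Y' x) -> run u Y e s r -> run u' Y' e s r.
Proof.
move=> le YY; rewrite /run; mono; case: (bit _ _) => //=.
by apply: just_mono.
Qed.

Lemma just_nthJ u M Y i a r : just u M Y (nthJ i a r) -> just_nth u M i a r.
Proof.
move=> /exbP[x _ /exbP[b _ /exbP[q _]]] /or3P[] /andP[/eqP/npair_inj[//]].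
by move=> _ /npair_inj[-> /npair_inj[-> ->]].
Qed.

Lemma just_evsJ u M Y i a r : just u M Y (evsJ i a r) -> just_evs u M i a r.
Proof.
move=> /exbP[x _ /exbP[b _ /exbP[q _]]] /or3P[] /andP[/eqP/npair_inj[//]].
by move=> _ /npair_inj[-> /npair_inj[-> ->]].
Qed.

Lemma just_evJ u M Y i a r : just u M Y (evJ i a r) -> just_ev u M Y i a r.
Proof.
move=> /exbP[x _ /exbP[b _ /exbP[q _]]] /or3P[] /andP[/eqP/npair_inj[//]].
by move=> _ /npair_inj[-> /npair_inj[-> ->]].
Qed.

(** * Soundness of coded computations *)

Section Soundness.
Variables (u : nat) (M Y : nat -> bool).
Hypothesis MJ : forall j, M j -> just u M Y j.

Lemma nthJ_sound l i r : M (nthJ i (list_code l) r) -> r = nth 0 l i.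
Proof.
elim: l i => [|x l IH] i /MJ/just_nthJ /or3P[].
- by move=> /= /eqP->; rewrite nth_nil.
- by move=> /andP[_ /exbP[t _ /eqP]].
- by move=> /exbP[i' _ /exbP[h _ /exbP[t _ /and3P[_ /eqP]]]].
- by [].
- by move=> /andP[/eqP-> /exbP[t _ /eqP /cons_code_inj[]]].
move=> /exbP[i' _ /exbP[h _ /exbP[t _ /and3P[/eqP-> /eqP/cons_code_inj[_ <-]]]]].
exact: IH.
Qed.

Lemma evJ_sound e a r : M (evJ (prf_code e) (list_code a) r) -> peval Y e a r.
Proof.
have inj x y x' y' : npair x y = npair x' y' -> (x = x') * (y = y').
  by case/npair_inj.
move: e a r; apply: prf_nested_ind => [||i||f gs IHf IHgs|f g IHf IHg|f IHf].
(* The [PComp] case goes first because it uses [prf_code_comp]; in the other cases [prf_code]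
   simplifies directly. *)
1-4,6,7: shelve.
- move=> a r /MJ/just_evJ; rewrite prf_code_comp => H.
  suff: exists f' gs' ys, [/\ npair 4 (npair (prf_code f) (prfs_code gs))
    = npair 4 (npair f' gs'),
      M (evsJ gs' (list_code a) ys) & M (evJ f' ys r)].
    case=> f' [gs' [ys [/inj[_ /inj[<- <-]] Hs Hf]]].
    suff [l El Hl] : exists2 l, ys = list_code l & pevals Y gs a l.
      by subst ys; apply: ev_comp Hl _; apply: IHf.
    elim: gs ys IHgs Hs {Hf H} => [|g gs IH] ys IHgs /MJ/just_evsJ/orP[].
    + by move=> /andP[_ /eqP->]; exists [::] => //; apply: evs_nil.
    + by move=> /exbP[? _ /exbP[? _ /exbP[? _ /exbP[? _ /and4P[/eqP]]]]].
    + by [].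
    move=> /exbP[g' _ /exbP[gs'' _ /exbP[y _ /exbP[ys' _]]]].
    move=> /and4P[/eqP/cons_code_inj[<- <-] /eqP-> Hg Hgs].
    have [l -> Hl] := IH ys' (fun i => IHgs i.+1) Hgs.
    by exists (y :: l) => //; apply: evs_cons => //; apply: (IHgs 0 isT).
  move: H; rewrite /just_ev => /or4P[/andP[/eqP/inj[]]|/andP[/eqP/inj[]]|
    /exbP[? _ /andP[/eqP/inj[]]]|/or4P[/andP[/eqP/inj[]]| | |/orP[]]] //.
  + move=> /exbP[f' _ /exbP[gs' _ /exbP[ys _ /and3P[/eqP E Hs Hf]]]].
    by exists f', gs', ys.
  + by move=> /exbP[? _ /exbP[? _ /exbP[? _ /and3P[/eqP/inj[]]]]].
  + by move=> /exbP[? _ /exbP[? _ /exbP[? _ /exbP[? _ /exbP[? _ /and4P[/eqP/inj[]]]]]]].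
  + by move=> /exbP[? _ /and3P[/eqP/inj[]]].
Unshelve.
all: rewrite /=.
- move=> a r /MJ/just_evJ.
  rewrite /just_ev => /or4P[|/andP[/eqP/inj[]]|
    /exbP[? _ /andP[/eqP/inj[]]]|/or4P[/andP[/eqP/inj[]]| | |/orP[]]] //.
  + by move=> /andP[_ /eqP->]; apply: ev_zero.
  + by move=> /exbP[? _ /exbP[? _ /exbP[? _ /and3P[/eqP/inj[]]]]].
  + by move=> /exbP[? _ /exbP[? _ /exbP[? _ /and3P[/eqP/inj[]]]]].
  + by move=> /exbP[? _ /exbP[? _ /exbP[? _ /exbP[? _ /exbP[? _ /and4P[/eqP/inj[]]]]]]].
  + by move=> /exbP[? _ /and3P[/eqP/inj[]]].
- move=> a r /MJ/just_evJ.
  rewrite /just_ev => /or4P[/andP[/eqP/inj[]]| |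
    /exbP[? _ /andP[/eqP/inj[]]]|/or4P[/andP[/eqP/inj[]]| | |/orP[]]] //.
  + move=> /andP[_ /exbP[q _ /andP[/eqP-> /nthJ_sound->]]]; exact: ev_succ.
  + by move=> /exbP[? _ /exbP[? _ /exbP[? _ /and3P[/eqP/inj[]]]]].
  + by move=> /exbP[? _ /exbP[? _ /exbP[? _ /and3P[/eqP/inj[]]]]].
  + by move=> /exbP[? _ /exbP[? _ /exbP[? _ /exbP[? _ /exbP[? _ /and4P[/eqP/inj[]]]]]]].
  + by move=> /exbP[? _ /and3P[/eqP/inj[]]].
- move=> a r /MJ/just_evJ.
  rewrite /just_ev => /or4P[/andP[/eqP/inj[]]|/andP[/eqP/inj[]]|
    |/or4P[/andP[/eqP/inj[]]| | |/orP[]]] //.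
  + move=> /exbP[q _ /andP[/eqP/inj[_ <-] /nthJ_sound->]]; exact: ev_proj.
  + by move=> /exbP[? _ /exbP[? _ /exbP[? _ /and3P[/eqP/inj[]]]]].
  + by move=> /exbP[? _ /exbP[? _ /exbP[? _ /and3P[/eqP/inj[]]]]].
  + by move=> /exbP[? _ /exbP[? _ /exbP[? _ /exbP[? _ /exbP[? _ /and4P[/eqP/inj[]]]]]]].
  + by move=> /exbP[? _ /and3P[/eqP/inj[]]].
- move=> a r /MJ/just_evJ.
  rewrite /just_ev => /or4P[/andP[/eqP/inj[]]|/andP[/eqP/inj[]]|
    /exbP[? _ /andP[/eqP/inj[]]]|/or4P[| | |/orP[]]] //.
  + move=> /andP[_ /exbP[q _ /andP[/nthJ_sound-> /eqP->]]]; exact: ev_oracle.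
  + by move=> /exbP[? _ /exbP[? _ /exbP[? _ /and3P[/eqP/inj[]]]]].
  + by move=> /exbP[? _ /exbP[? _ /exbP[? _ /and3P[/eqP/inj[]]]]].
  + by move=> /exbP[? _ /exbP[? _ /exbP[? _ /exbP[? _ /exbP[? _ /and4P[/eqP/inj[]]]]]]].
  + by move=> /exbP[? _ /and3P[/eqP/inj[]]].
- have inv a r : M (evJ (prf_code (PPrec f g)) (list_code a) r) ->
    (exists2 rest, a = 0 :: rest & M (evJ (prf_code f) (list_code rest) r)) \/
    (exists n rest q, [/\ a = n.+1 :: rest,
       M (evJ (prf_code (PPrec f g)) (list_code (n :: rest)) q) &
       M (evJ (prf_code g) (list_code [:: n, q & rest]) r)]).
    move=> /MJ/just_evJ.
    rewrite /just_ev => /or4P[/andP[/eqP/inj[]]|/andP[/eqP/inj[]]|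
      /exbP[? _ /andP[/eqP/inj[]]]|/or4P[/andP[/eqP/inj[]]| | |/orP[]]] //.
    + by move=> /exbP[? _ /exbP[? _ /exbP[? _ /and3P[/eqP/inj[]]]]].
    + move=> /exbP[f' _ /exbP[g' _ /exbP[rest _ /and3P[/eqP/inj[_ /inj[<- _]]]]]].
      case: a => //= n rest' /eqP/cons_code_inj[-> <-] H; left.
      by exists rest'.
    + move=> /exbP[f' _ /exbP[g' _ /exbP[rest _ /exbP[n _ /exbP[q _]]]]].
      move=> /and4P[/eqP/inj[_ /inj[_ <-]]].
      case: a => //= n' rest' /eqP/cons_code_inj[-> <-] H1 H2; right.
      by exists n, rest', q.
    + by move=> /exbP[? _ /and3P[/eqP/inj[]]].
  case=> [|n rest] r.
    by move=> /inv [[]|[? [? [? []]]]].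
  elim: n r => [|n IHn] r /inv [[rest' //]|[n' [rest' [q []]]]] //.
    by case=> <- /IHf; apply: ev_prec0.
  by case=> <- <- /IHn H1 /IHg; apply: ev_precS.
- move=> a r /MJ/just_evJ.
  rewrite /just_ev => /or4P[/andP[/eqP/inj[]]|/andP[/eqP/inj[]]|
    /exbP[? _ /andP[/eqP/inj[]]]|/or4P[/andP[/eqP/inj[]]| | |/orP[]]] //.
  + by move=> /exbP[? _ /exbP[? _ /exbP[? _ /and3P[/eqP/inj[]]]]].
  + by move=> /exbP[? _ /exbP[? _ /exbP[? _ /and3P[/eqP/inj[]]]]].
  + by move=> /exbP[? _ /exbP[? _ /exbP[? _ /exbP[? _ /exbP[? _ /and4P[/eqP/inj[]]]]]]].
  + move=> /exbP[f' _ /and3P[/eqP/inj[_ <-] H0 /allbP Hm]].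
    apply: ev_mu => [|m /Hm/exbP[k _ Hk]]; first exact: (IHf (r :: a)).
    by exists k; apply: (IHf (m :: a)).
Qed.
End Soundness.

Lemma run_sound u Y e s r : run u Y (prf_code e) s r -> peval Y e [:: s] r.
Proof.
move=> /exbP[d _ /andP[/allbP J]] H.
apply: (@evJ_sound u (bit d)) => // j dj.
by have := J j (bit_lt dj); rewrite dj.
Qed.

(** * Completeness of coded computations *)

Section Completeness.
Variable Y : nat -> bool.

Definition good u (M : nat -> bool) :=
  (forall x, M x -> x < u) /\ (forall x, M x -> just u M Y x).

(** A derivation is a bounded set whose members justify one another; such sets combine by union, so
    no tree structure is kept. *)
Definition derivable (L : seq nat) := exists u M, good u M /\ {subset L <= M}.

Lemma good_mono u u' M : u <= u' -> good u M -> good u' M.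
Proof.
move=> le [H1 H2]; split=> x Mx; first by have := H1 x Mx; lia.
by apply: just_mono (H2 x Mx).
Qed.

Lemma derivable_cat L L' : derivable L -> derivable L' -> derivable (L ++ L').
Proof.
move=> [u [M [/(good_mono (leq_maxl u _)) g s]]] [u' [M' [/(good_mono (leq_maxr _ u')) g' s']]].
exists (maxn u u'), (fun x => M x || M' x); split; last first.
  move=> x; rewrite mem_cat => H; suff: M x || M' x by [].
  by case/orP: H => [/s H|/s' H]; apply/orP; [left | right].
case: (g u') (g' u) => b j [b' j']; split=> x /orP[Mx|Mx]; auto.
  by apply: just_mono (j x Mx) => // y ->.
by apply: just_mono (j' x Mx) => // y ->; rewrite orbT.
Qed.

(** [w] bounds the witnesses needed to justify [j]; the bound of the set may always be raised past
    it. *)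
Lemma derivable_add L j w :
  derivable L -> (forall u M, w <= u -> {subset L <= M} -> just u M Y j) ->
  derivable [:: j].
Proof.
move=> [u [M [g s]]] J.
pose W := maxn u (maxn w j.+1); pose M' x := M x || (x == j).
have [b jM] : good W M by apply: good_mono g; rewrite /W; lia.
exists W, M'; split; last first.
  by move=> x; rewrite inE => /eqP->; change (M' j); rewrite /M' eqxx orbT.
split=> x /orP[Mx|/eqP->]; auto; first by rewrite /W; lia.
- by apply: just_mono (jM x Mx) => // y; rewrite /M' => ->.
- apply: J => [|y /s My]; first by rewrite /W; lia.
  by change (M' y); apply/orP; left.
Qed.

Lemma just_wit u M x a r j :
  x < u -> a < u -> r < u ->
  [|| (j == nthJ x a r) && just_nth u M x a r,
        (j == evsJ x a r) && just_evs u M x a r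
      | (j == evJ x a r) && just_ev u M Y x a r] -> just u M Y j.
Proof.
by move=> lx la lr H; apply/exbP; exists x => //; apply/exbP; exists a => //; apply/exbP;
  exists r.
Qed.

Lemma derivable_nth l i : derivable [:: nthJ i (list_code l) (nth 0 l i)].
Proof.
have d0 : derivable [::] by exists 0, (fun=> false); split.
elim: l i => [|x l IH] i.
  apply: (derivable_add (w := i.+1)) d0 _ => u M le _.
  rewrite nth_nil; apply: (@just_wit _ _ i 0 0); rewrite /= ?eqxx //; lia.
case: i => [|i] /=.
  apply: (derivable_add (w := (cons_code x (list_code l) + x + list_code l).+1)) d0 _ => u M le _.
  apply: (@just_wit _ _ 0 (cons_code x (list_code l)) x); try lia.
  rewrite eqxx /= /just_nth (_ : exb _ _ = true) ?orbT //.
  by apply/exbP; exists (list_code l) => //; lia.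
pose a := cons_code x (list_code l).
apply: (derivable_add (w := (i + a + nth 0 l i + x + list_code l).+2)) (IH i) _ => u M le s.
apply: (@just_wit _ _ i.+1 a (nth 0 l i)); try lia.
rewrite eqxx /= /just_nth; apply/orP; left; apply/or3P/Or33.
apply/exbP; exists i; first lia.
apply/exbP; exists x; first lia.
apply/exbP; exists (list_code l); first lia.
by rewrite !eqxx /=; apply: s; rewrite inE.
Qed.

Lemma derivable_step L w e a r :
  derivable L -> (forall u M, w <= u -> {subset L <= M} -> just_ev u M Y e a r) ->
  derivable [:: evJ e a r].
Proof.
move=> dL J; apply: (derivable_add (w := w + (e + a + r).+1)) dL _ => u M le s.
apply: (@just_wit _ _ e a r); try lia.
by rewrite (J u M) ?eqxx ?orbT //; lia.
Qed.

(** Minimisation has one premise for each smaller argument; the bounded search in [just_ev] requires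
    a common bound [w] on their values. *)
Lemma derivable_all n (j : nat -> nat -> nat) :
  (forall m, m < n -> exists k, derivable [:: j m k]) ->
  exists L w, derivable L /\ forall m, m < n -> exists2 k, k < w & j m k \in L.
Proof.
elim: n => [|n IH] H.
  by exists [::], 0; split=> //; exists 0, (fun=> false); split.
have [|L [w [dL HL]]] := IH; first by move=> m lt; apply: H; lia.
have [k dk] := H n (ltnSn n).
exists (L ++ [:: j n k]), (maxn w k.+1); split; first exact: derivable_cat.
move=> m; rewrite ltnS leq_eqVlt => /orP[/eqP->|/HL[k' lt jm]].
  by exists k; [lia | rewrite mem_cat inE eqxx orbT].
by exists k'; [lia | rewrite mem_cat jm].
Qed.

Lemma evJ_complete e a r : peval Y e a r -> derivable [:: evJ (prf_code e) (list_code a) r].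
Proof.
have d0 : derivable [::] by exists 0, (fun=> false); split.
move: e a r; apply: prf_nested_ind => [||i||f gs IHf IHgs|f g IHf IHg|f IHf] a r H.
- inversion H; subst; apply: (derivable_step (w := 0)) d0 _ => u M _ _.
  by rewrite /just_ev !eqxx.
- inversion H; subst; apply: (derivable_step (w := (nth 0 a 0).+1)) (derivable_nth a 0)
    _ => u M le s.
  apply/or4P/Or42; rewrite eqxx /=; apply/exbP; exists (nth 0 a 0) => //.
  by rewrite eqxx /=; apply: s; rewrite inE.
- inversion H; subst; apply: (derivable_step (w := i.+1)) (derivable_nth a i) _ => u M le s.
  apply/or4P/Or43; apply/exbP; exists i => //.
  by rewrite eqxx /=; apply: s; rewrite inE.
- inversion H; subst; apply: (derivable_step (w := (nth 0 a 0).+1)) (derivable_nth a 0)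
    _ => u M le s.
  apply/or4P/Or44/or4P/Or41; rewrite eqxx /=; apply/exbP; exists (nth 0 a 0) => //.
  by rewrite eqxx andbT; apply: s; rewrite inE.
- inversion H as [| | | |f1 gs1 a1 ys r1 Hs Hf| | |]; subst.
  have Ds : derivable [:: evsJ (prfs_code gs) (list_code a) (list_code ys)].
    elim: gs IHgs ys Hs {H Hf} => [|g gs IH] IHgs ys Hs.
      inversion Hs; subst.
      apply: (derivable_add (w := (list_code a).+1)) d0 _ => u M le _.
      by apply: (@just_wit _ _ 0 (list_code a) 0); rewrite ?eqxx ?orbT; try lia.
    inversion Hs as [|g1 gs1 a1 y zs Hg Hgs]; subst.
    have D1 := IHgs 0 isT _ _ Hg.
    have D2 := IH (fun i => IHgs i.+1) _ Hgs.
    rewrite /prfs_code /= -/(prfs_code gs).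
    pose x := cons_code (prf_code g) (prfs_code gs); pose z := cons_code y (list_code zs).
    apply: (derivable_add (w := (x + z + list_code a + prf_code g + prfs_code gs + y +
      list_code zs).+1))
      (derivable_cat D1 D2) _ => u M le s.
    apply: (@just_wit _ _ x (list_code a) z); try lia.
    rewrite eqxx /= /just_evs; apply/or3P/Or32/orP; right.
    apply/exbP; exists (prf_code g); first lia.
    apply/exbP; exists (prfs_code gs); first lia.
    apply/exbP; exists y; first lia.
    apply/exbP; exists (list_code zs); first lia.
    by rewrite !eqxx /=; apply/andP; split; apply: s; rewrite !inE eqxx ?orbT.
  rewrite prf_code_comp.
  apply: (derivable_step (w := (prf_code f + prfs_code gs + list_code ys).+1))
    (derivable_cat Ds (IHf _ _ Hf)) _ => u M le s.
  apply/or4P/Or44/or4P/Or42.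
  apply/exbP; exists (prf_code f); first lia.
  apply/exbP; exists (prfs_code gs); first lia.
  apply/exbP; exists (list_code ys); first lia.
  by rewrite eqxx /=; apply/andP; split; apply: s; rewrite !inE eqxx ?orbT.
- case: a H => [|n rest] H; first by inversion H.
  elim: n r H => [|n IHn] r H.
    inversion H as [| | | | |f1 g1 rest1 r1 Hf| |]; subst.
    apply: (derivable_step (w := (prf_code f + prf_code g + list_code rest).+1))
      (IHf _ _ Hf) _ => u M le s.
    apply/or4P/Or44/or4P/Or43.
    apply/exbP; exists (prf_code f); first lia.
    apply/exbP; exists (prf_code g); first lia.
    apply/exbP; exists (list_code rest); first lia.
    by rewrite !eqxx /=; apply: s; rewrite !inE eqxx ?orbT.
  inversion H as [| | | | | |f1 g1 n1 rest1 q r1 Hq Hg|]; subst.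
  apply: (derivable_step (w := (prf_code f + prf_code g + list_code rest + n + q).+1))
      (derivable_cat (IHn _ Hq) (IHg _ _ Hg)) _ => u M le s.
  apply/or4P/Or44/or4P/Or44/orP; left.
  apply/exbP; exists (prf_code f); first lia.
  apply/exbP; exists (prf_code g); first lia.
  apply/exbP; exists (list_code rest); first lia.
  apply/exbP; exists n; first lia.
  apply/exbP; exists q; first lia.
  by rewrite !eqxx /=; apply/andP; split; apply: s; rewrite !inE eqxx ?orbT.
- inversion H as [| | | | | | |f1 a1 n1 H0 Hlt]; subst.
  have [m lt|L [w [DL HL]]] :=
    @derivable_all r (fun m k => evJ (prf_code f) (cons_code m (list_code a)) k.+1).
    by have [k Hk] := Hlt m lt; exists k; apply: (IHf (m :: a)).
  apply: (derivable_step (w := maxn w (prf_code f).+1)) (derivable_cat DL (IHf _ _ H0))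
    _ => u M le s.
  apply/or4P/Or44/or4P/Or44/orP; right.
  apply/exbP; exists (prf_code f); first lia.
  rewrite eqxx /=; apply/andP; split.
    by apply: s; rewrite mem_cat inE eqxx orbT.
  apply/allbP => m /HL[k lt mL]; apply/exbP; exists k; first lia.
  by apply: s; rewrite mem_cat mL.
Qed.
End Completeness.

Lemma run_complete Y e s r :
  peval Y e [:: s] r -> exists u, run u Y (prf_code e) s r.
Proof.
move=> /evJ_complete[u [M [[b J] S]]].
have bM x : bit (bitmask M u) x = M x.
  by rewrite bit_bitmask; case: (boolP (M x)) => [/b->|]; rewrite ?andbF.
(* The bound has to exceed the number that codes the derivation itself. *)
exists (maxn u (bitmask M u).+1); apply/exbP; exists (bitmask M u); first lia.
apply/andP; split; last by rewrite bM; apply: S; rewrite inE.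
apply/allbP => j _; apply/implyP; rewrite bM => /J.
by apply: just_mono => // [|x]; [lia | rewrite bM].
Qed.

(** * Computable functions *)

Definition env := nat -> nat.

(** Variables are read from an environment in de Bruijn style: a bounded quantifier makes its
    variable number 0 and shifts the others. Since the equation holds for every [v], only the first
    [k] entries can matter to [f]. *)
Definition computable_fun k (f : env -> nat) :=
  exists e, forall v, peval empty_oracle e (mkseq v k) (f v).

Definition computable_pred k (p : env -> bool) := computable_fun k (fun v => nat_of_bool (p v)).

Definition scons a (v : env) : env := fun i => if i is i'.+1 then v i' else a.

Lemma mkseq_scons a v k : mkseq (scons a v) k.+1 = a :: mkseq v k.
Proof. by rewrite /mkseq /= -[1]/(1 + 0) iotaDl -map_comp. Qed.

Lemma pevals_proj X k (v : env) l : (forall i, i \in l -> i < k) ->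
  pevals X (map PProj l) (mkseq v k) (map v l).
Proof.
elim: l => [|i l IH] H; first exact: evs_nil.
apply: evs_cons; last by apply: IH => j jl; apply: H; rewrite inE jl orbT.
rewrite -(@nth_mkseq _ 0 v k); first exact: ev_proj.
by apply: H; rewrite inE eqxx.
Qed.

Definition projs k := map PProj (iota 0 k).

Lemma pevals_projs X k v : pevals X (projs k) (mkseq v k) (mkseq v k).
Proof. by apply: pevals_proj => i; rewrite mem_iota. Qed.

Lemma cf_ext k f g : f =1 g -> computable_fun k f -> computable_fun k g.
Proof. by move=> E [e H]; exists e => v; rewrite -E. Qed.

Lemma cp_ext k (p q : env -> bool) : p =1 q -> computable_pred k p -> computable_pred k q.
Proof. by move=> E; apply: cf_ext => v; rewrite E. Qed.

Lemma cf_var k i : i < k -> computable_fun k (fun v => v i).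
Proof.
by move=> lt; exists (PProj i) => v; rewrite -(@nth_mkseq _ 0 v k) //; apply: ev_proj.
Qed.

Lemma cf_comp k m F (gs : nat -> env -> nat) :
  computable_fun m F -> (forall i, i < m -> computable_fun k (gs i)) ->
    computable_fun k (fun v => F (fun i => gs i v)).
Proof.
move=> [e He] H.
suff [es Hes] : exists es, forall v, pevals empty_oracle es (mkseq v k)
  (mkseq (fun i => gs i v) m).
  by exists (PComp e es) => v; apply: ev_comp (Hes v) (He _).
elim: m gs H {e He} => [|m IH] gs H; first by exists [::] => v; apply: evs_nil.
have [e He] := H 0 isT.
have [es Hes] := IH (fun i => gs i.+1) (fun i => H i.+1).
exists (e :: es) => v.
have -> : mkseq (fun i => gs i v) m.+1 = gs 0 v :: mkseq (fun i => gs i.+1 v) m.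
  by rewrite -mkseq_scons; apply: eq_mkseq => -[].
exact: evs_cons.
Qed.

Fixpoint natrec (a : nat) (g : nat -> nat -> nat) n :=
  if n is n'.+1 then g n' (natrec a g n') else a.

(** In [g], variable 0 is the counter, variable 1 the previous value, and the parameters are shifted
    by two. *)
Lemma cf_rec k (b f : env -> nat) (g : nat -> nat -> env -> nat) :
  computable_fun k b -> computable_fun k f ->
    computable_fun k.+2 (fun w => g (w 0) (w 1) (fun i => w i.+2)) ->
  computable_fun k (fun v => natrec (f v) (fun n r => g n r v) (b v)).
Proof.
move=> [eb Hb] [ef Hf] [eg Hg].
exists (PComp (PPrec ef eg) (eb :: projs k)) => v.
apply: ev_comp; first by apply: evs_cons (Hb v) (pevals_projs _ _ _).
elim: (b v) => [|n IH] /=; first exact: ev_prec0.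
apply: ev_precS IH _.
have := Hg (scons n (scons (natrec (f v) (fun n r => g n r v) n) v)).
by rewrite !mkseq_scons.
Qed.

Lemma cf_S k f : computable_fun k f -> computable_fun k (fun v => (f v).+1).
Proof.
move=> [e He]; exists (PComp PSucc [:: e]) => v.
by apply: ev_comp (evs_cons (He v) (evs_nil _ _)) _; apply: (@ev_succ _ [:: f v]).
Qed.

Lemma cf_const k n : computable_fun k (fun => n).
Proof.
elim: n => [|n IH]; last exact: cf_S IH.
by exists PZero => v; apply: ev_zero.
Qed.

Lemma cf_comp1 k (F : nat -> nat) f : computable_fun 1 (fun v => F (v 0)) ->
  computable_fun k f -> computable_fun k (fun v => F (f v)).
Proof. by move=> HF Hf; apply: (cf_comp (gs := fun i => f) HF). Qed.

Lemma cf_pred k f : computable_fun k f -> computable_fun k (fun v => (f v).-1).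
Proof.
move=> Hf; apply: cf_ext (_ : computable_fun k (fun v => natrec 0 (fun n _ => n) (f v))).
  by move=> v; case: (f v).
by apply: (cf_rec (f := fun=> 0) (g := fun n _ _ => n)) => //; [apply: cf_const | apply: cf_var].
Qed.

Lemma cf_add k f g : computable_fun k f -> computable_fun k g ->
  computable_fun k (fun v => f v + g v).
Proof.
move=> Hf Hg; apply: cf_ext (_ : computable_fun k (fun v => natrec (f v) (fun _ r => r.+1)
  (g v))).
  by move=> v; elim: (g v) => [|n IH] /=; rewrite ?addn0 ?addnS ?IH.
by apply: (cf_rec (g := fun _ r _ => r.+1)) => //; apply/cf_S/cf_var.
Qed.

Lemma cf_mul k f g : computable_fun k f -> computable_fun k g ->
  computable_fun k (fun v => f v * g v).
Proof.
move=> Hf Hg.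
have H2 : computable_fun 2 (fun v => v 0 * v 1).
  apply: cf_ext (_ : computable_fun 2 (fun v => natrec 0 (fun _ r => r + v 0) (v 1))).
    by move=> v; elim: (v 1) => [|n IH] /=; rewrite ?muln0 ?mulnSr ?IH.
  apply: (cf_rec (f := fun=> 0) (g := fun _ r v => r + v 0)); rewrite ?cf_const //;
    try exact: cf_var.
    exact: cf_const.
  by apply: cf_add; apply: cf_var.
apply: (cf_comp (gs := fun i => if i is 0 then f else g) H2) => -[|[]] //.
Qed.

Lemma cf_sub k f g : computable_fun k f -> computable_fun k g ->
  computable_fun k (fun v => f v - g v).
Proof.
move=> Hf Hg; apply: cf_ext (_ : computable_fun k (fun v => natrec (f v) (fun _ r => r.-1)
  (g v))).
  by move=> v; elim: (g v) => [|n IH] /=; rewrite ?subn0 ?subnS ?IH.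
by apply: (cf_rec (g := fun _ r _ => r.-1)) => //; apply/cf_pred/cf_var.
Qed.

Lemma cp_cf k p : computable_pred k p -> computable_fun k (fun v => nat_of_bool (p v)).
Proof. by []. Qed.

Lemma cp_eq0 k f : computable_fun k f -> computable_pred k (fun v => f v == 0).
Proof.
move=> Hf; apply: cf_ext (_ : computable_fun k (fun v => 1 - f v)); first by move=> v;
  case: (f v).
exact/cf_sub/Hf/cf_const.
Qed.

Lemma cp_neg k p : computable_pred k p -> computable_pred k (fun v => ~~ p v).
Proof. by move=> /cp_cf/cp_eq0; apply: cp_ext => v; case: (p v). Qed.

Lemma cp_and k p q : computable_pred k p -> computable_pred k q ->
  computable_pred k (fun v => p v && q v).
Proof.
by move=> Hp Hq; apply: cf_ext (cf_mul Hp Hq) => v; case: (p v); case: (q v).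
Qed.

Lemma cp_or k p q : computable_pred k p -> computable_pred k q ->
  computable_pred k (fun v => p v || q v).
Proof.
move=> /cp_neg Hp /cp_neg Hq; apply: cp_ext (cp_neg (cp_and Hp Hq)) => v.
by rewrite negb_and !negbK.
Qed.

Lemma cp_imp k p q : computable_pred k p -> computable_pred k q ->
  computable_pred k (fun v => p v ==> q v).
Proof.
move=> /cp_neg Hp Hq; apply: cp_ext (cp_or Hp Hq) => v.
by rewrite implybE.
Qed.

Lemma cp_leq k f g : computable_fun k f -> computable_fun k g ->
  computable_pred k (fun v => f v <= g v).
Proof. by move=> Hf Hg; apply: cp_eq0; apply: cf_sub. Qed.

Lemma cp_eqn k f g : computable_fun k f -> computable_fun k g ->
  computable_pred k (fun v => f v == g v).
Proof.
move=> Hf Hg; apply: cp_ext (cp_and (cp_leq Hf Hg) (cp_leq Hg Hf)) => v.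
by rewrite eqn_leq.
Qed.

Lemma cp_eqb k p q : computable_pred k p -> computable_pred k q ->
  computable_pred k (fun v => p v == q v).
Proof. by move=> Hp Hq; apply: cp_ext (cp_eqn Hp Hq) => v; case: (p v); case: (q v). Qed.

Lemma cp_const k b : computable_pred k (fun=> b).
Proof. exact: cf_const. Qed.

Lemma cf_if k p f g : computable_pred k p -> computable_fun k f -> computable_fun k g ->
  computable_fun k (fun v => if p v then f v else g v).
Proof.
move=> Hp Hf Hg; apply: cf_ext (cf_add (cf_mul Hp Hf) (cf_mul (cp_neg Hp) Hg)) => v.
by case: (p v); rewrite !(mul1n, mul0n) // addn0.
Qed.

Lemma cp_all k b (p : env -> nat -> bool) :
  computable_fun k b -> computable_pred k.+1 (fun w => p (fun i => w i.+1) (w 0)) ->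
  computable_pred k (fun v => allb (b v) (p v)).
Proof.
move=> Hb Hp.
apply: cf_ext (_ : computable_fun k (fun v => natrec 1 (fun n r => r * p v n) (b v))).
  move=> v; elim: (b v) => [|n IH] //=; rewrite IH allbS.
  by case: (allb _ _); case: (p v n).
apply: (cf_rec (f := fun=> 1) (g := fun n r v => r * p v n)) => //; first exact: cf_const.
apply: cf_mul; first exact: cf_var.
apply: (cf_comp (gs := fun i v => if i is 0 then v 0 else v i.+1) Hp) => -[|i] lt;
  exact: cf_var.
Qed.

Lemma cp_ex k b (p : env -> nat -> bool) :
  computable_fun k b -> computable_pred k.+1 (fun w => p (fun i => w i.+1) (w 0)) ->
  computable_pred k (fun v => exb (b v) (p v)).
Proof.
move=> Hb /cp_neg Hp.
by apply: cp_ext (cp_neg (cp_all (p := fun v n => ~~ p v n) Hb Hp)) => v; rewrite exb_negb.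
Qed.

Lemma cf_npair k f g : computable_fun k f -> computable_fun k g ->
  computable_fun k (fun v => npair (f v) (g v)).
Proof. by move=> Hf Hg; apply: cf_add => //; apply: cf_mul; apply: cf_add. Qed.

Lemma cp_odd k f : computable_fun k f -> computable_pred k (fun v => odd (f v)).
Proof.
move=> Hf; apply: cf_ext (_ : computable_fun k (fun v => natrec 0 (fun _ r => r == 0) (f v))).
  by move=> v; elim: (f v) => //= n ->; case: (odd n).
apply: (cf_rec (f := fun=> 0) (g := fun _ r v => r == 0)) => //; first exact: cf_const.
by apply: (@cp_eq0 _ (fun v => v 1)); apply: cf_var.
Qed.

Lemma cf_half k f : computable_fun k f -> computable_fun k (fun v => (f v)./2).
Proof.
move=> Hf; apply: cf_ext (_ : computable_fun k (fun v => natrec 0 (fun n r => odd n + r) (f v))).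
  by move=> v; elim: (f v) => //= n ->; rewrite uphalf_half.
apply: (cf_rec (f := fun=> 0) (g := fun n r v => odd n + r)) => //; first exact: cf_const.
by apply: cf_add; [apply/cp_odd/cf_var | apply: cf_var].
Qed.

Lemma cf_iter k F f g : computable_fun 1 (fun v => F (v 0)) -> computable_fun k f ->
  computable_fun k g ->
  computable_fun k (fun v => iter (f v) F (g v)).
Proof.
move=> HF Hf Hg; apply: cf_ext (_ : computable_fun k (fun v => natrec (g v) (fun _ r => F r)
  (f v))).
  by move=> v; elim: (f v) => //= n ->.
by apply: (cf_rec (g := fun _ r v => F r)) => //; apply: cf_comp1 => //; apply: cf_var.
Qed.

Lemma cp_bit k f g : computable_fun k f -> computable_fun k g ->
  computable_pred k (fun v => bit (f v) (g v)).
Proof. by move=> Hf Hg; apply/cp_odd/cf_iter => //; apply/cf_half/cf_var. Qed.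

Lemma cf_exp2 k f : computable_fun k f -> computable_fun k (fun v => 2 ^ f v).
Proof.
move=> Hf; apply: cf_ext (_ : computable_fun k (fun v => iter (f v) (fun x => x + x) 1)).
  by move=> v; elim: (f v) => //= n ->; rewrite expnS; lia.
by apply: cf_iter => //; [apply: cf_add; apply: cf_var | apply: cf_const].
Qed.

Lemma cp_subst k (p : env -> bool) (gs : nat -> env -> nat) m :
  computable_pred m p -> (forall i, i < m -> computable_fun k (gs i)) ->
    computable_pred k (fun v => p (fun i => gs i v)).
Proof. exact: cf_comp. Qed.

Lemma cf_cons k f g : computable_fun k f -> computable_fun k g ->
  computable_fun k (fun v => cons_code (f v) (g v)).
Proof. by move=> Hf Hg; apply/cf_S/cf_npair. Qed.

Ltac cstep := first
  [ assumption
  | match goal with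
    | |- computable_pred _ (fun v => allb (@?b v) (fun y => @?p v y)) => apply: (@cp_all _ b p)
    | |- computable_pred _ (fun v => exb (@?b v) (fun y => @?p v y)) => apply: (@cp_ex _ b p)
    | |- computable_pred _ (fun v => @?p v && @?q v) => apply: (@cp_and _ p q)
    | |- computable_pred _ (fun v => @?p v || @?q v) => apply: (@cp_or _ p q)
    | |- computable_pred _ (fun v => @?p v ==> @?q v) => apply: (@cp_imp _ p q)
    | |- computable_pred _ (fun v => ~~ @?p v) => apply: (@cp_neg _ p)
    | |- computable_pred _ (fun v => @eq_op _ (@?f v) (@?g v))
      => first [apply: (@cp_eqn _ f g) | apply: (@cp_eqb _ f g)]
    | |- computable_pred _ (fun v => leq (@?f v) (@?g v)) => apply: (@cp_leq _ f g)
    | |- computable_pred _ (fun v => bit (@?f v) (@?g v)) => apply: (@cp_bit _ f g)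
    | |- computable_pred _ (fun v => odd (@?f v)) => apply: (@cp_odd _ f)
    | |- computable_pred _ (fun v => ?b) => apply: cp_const
    | |- computable_fun _ (fun v => v ?i) => by apply: cf_var
    | |- computable_fun _ (fun v => ?n) => apply: cf_const
    | |- computable_fun _ (fun v => nat_of_bool (@?p v)) => apply: (@cp_cf _ p)
    | |- computable_fun _ (fun v => npair (@?f v) (@?g v)) => apply: (@cf_npair _ f g)
    | |- computable_fun _ (fun v => cons_code (@?f v) (@?g v)) => apply: (@cf_cons _ f g)
    | |- computable_fun _ (fun v => S (@?f v)) => apply: (@cf_S _ f)
    | |- computable_fun _ (fun v => predn (@?f v)) => apply: (@cf_pred _ f)
    | |- computable_fun _ (fun v => half (@?f v)) => apply: (@cf_half _ f)
    | |- computable_fun _ (fun v => addn (@?f v) (@?g v)) => apply: (@cf_add _ f g)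
    | |- computable_fun _ (fun v => expn 2 (@?f v)) => apply: (@cf_exp2 _ f)
    end ].
Ltac computable := repeat cstep.

(** Universal evaluation is built from bounded quantifiers over arithmetic, the finite oracle being
    given by its canonical index. *)
Lemma cp_run5 : computable_pred 5 (fun v => run (v 0) (bit (v 1)) (v 2) (v 3) (v 4)).
Proof.
rewrite /run /just /just_nth /just_evs /just_ev /evJ /evsJ /nthJ.
by computable.
Qed.

Lemma cp_run k u y e s r : computable_fun k u -> computable_fun k y -> computable_fun k e ->
  computable_fun k s -> computable_fun k r ->
  computable_pred k (fun v => run (u v) (bit (y v)) (e v) (s v) (r v)).
Proof.
move=> Hu Hy He Hs Hr.
by apply: (cp_subst (gs := fun i v => nth 0 [:: u v; y v; e v; s v; r v] i) cp_run5)
  => -[|[|[|[|[]]]]].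
Qed.

Lemma unbounded_search (p : nat -> nat -> bool) :
  computable_pred 2 (fun v => p (v 0) (v 1)) -> (forall n, exists m, p n m) ->
  exists m : nat -> nat, computable_fun 1 (fun v => m (v 0)) /\ forall n, p n (m n).
Proof.
move=> Hp H; exists (fun n => ex_minn (H n)); split; last by move=> n; case: ex_minnP.
have [e He] : computable_pred 2 (fun v => ~~ p (v 1) (v 0)).
  apply: cp_neg.
  by apply: (cp_subst (gs := fun i v => if i is 0 then v 1 else v 0) Hp) => -[|[]] // _;
    apply: cf_var.
exists (PMu e) => v; case: ex_minnP => m pm min; apply: ev_mu => [|m' lt].
  have := He (scons m v); rewrite mkseq_scons /mkseq /= pm.
  by [].
exists 0; have := He (scons m' v); rewrite mkseq_scons /mkseq /=.
by have -> : p (v 0) m' = false by apply/negP => /min; lia.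
Qed.

(** * The colouring *)

(** Dropping the first bit of a string sends its code [c] to [c.-1./2], and the first bit is true
    exactly when the code is positive and even. Past the end of the string the value is false. *)
Definition bitat j c := let t := iter j (fun x => x.-1./2) c in (0 < t) && ~~ odd t.

Lemma bitat_code j s : bitat j (code s) = nth false s j.
Proof.
elim: j s => [|j IH] [|b s] //=.
- by rewrite /bitat /=; case: b; rewrite ?addn2 ?addn1 /= oddM.
- by rewrite /bitat iterSr /= -/(bitat j 0) (IH [::]) nth_nil.
- have E : (2 * code s + (if b then 2 else 1)).-1./2 = code s by case: b; lia.
  by rewrite /bitat iterSr E -IH.
Qed.

Lemma code_surj c : exists s, code s = c.
Proof.
elim/ltn_ind: c => -[|c] IH; first by exists [::].
have [s Es] := IH c./2 ltac:(lia).
by exists (odd c :: s) => /=; rewrite Es; case: (boolP (odd c)); lia.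
Qed.

Lemma size_code s : size s <= code s.
Proof. by elim: s => //= b s IH; case: b; lia. Qed.

(** Bounding the output by [u] as well is what makes blocks outgrow the values of computable
    functions. *)
Definition halts e x u := exb u (fun r => run u (bit 0) e x r).

Lemma halts_mono e x u u' : u <= u' -> halts e x u -> halts e x u'.
Proof. by move=> le; apply: exb_mono => // r _; apply: run_mono. Qed.

(* The block starting at x is extended past l while some program e <= x is known
   at stage s to halt on x, but not within l steps. *)
Definition growing s x l := exb x.+1 (fun e => halts e x s && ~~ halts e x l).

(** The first element of the block containing [l], as seen at stage [s]; [block] then numbers the
    blocks from 0. *)
Definition start s l := natrec 0 (fun m a => if growing s a m.+1 then a else m.+1) l.

Definition block s l := natrec 0 (fun m k => k + (start s m.+1 == m.+1)) l.

(** A block numbered [npair (j + j + b) y] has kind [(j, b)]; the free component [y] makes every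
    kind recur on infinitely many blocks. The pairing is not surjective, and the remaining blocks
    get colour false. *)
Definition colour s c :=
  let k := block s c in
  exb k.+1 (fun j => exb k.+1 (fun y =>
    (k == npair (j + j) y) && bitat j c || (k == npair (j + j).+1 y) && ~~ bitat j c)).

Lemma cp_bitat k j c : computable_fun k j -> computable_fun k c ->
  computable_pred k (fun v => bitat (j v) (c v)).
Proof.
move=> Hj Hc; have H : computable_fun k (fun v => iter (j v) (fun x => x.-1./2) (c v)).
  by apply: cf_iter => //; computable.
by apply: cp_and; computable.
Qed.

Lemma cp_halts k e x u : computable_fun k e -> computable_fun k x -> computable_fun k u ->
  computable_pred k (fun v => halts (e v) (x v) (u v)).
Proof.
move=> He Hx Hu.
have H : computable_pred 3 (fun v => halts (v 0) (v 1) (v 2)).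
  rewrite /halts; apply: cp_ex; computable.
  by apply: (@cp_run _ _ (fun=> 0)); computable.
by apply: (cp_subst (gs := fun i v => nth 0 [:: e v; x v; u v] i) H) => -[|[|[]]].
Qed.

Lemma cp_growing k s x l :
  computable_fun k s -> computable_fun k x -> computable_fun k l ->
    computable_pred k (fun v => growing (s v) (x v) (l v)).
Proof.
move=> Hs Hx Hl.
have H : computable_pred 3 (fun v => growing (v 0) (v 1) (v 2)).
  by rewrite /growing; computable; apply: cp_halts; computable.
by apply: (cp_subst (gs := fun i v => nth 0 [:: s v; x v; l v] i) H) => -[|[|[]]].
Qed.

Lemma cf_start k s l : computable_fun k s -> computable_fun k l ->
  computable_fun k (fun v => start (s v) (l v)).
Proof.
move=> Hs Hl.
have H : computable_fun 2 (fun v => start (v 0) (v 1)).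
  apply: (cf_rec (f := fun=> 0) (g := fun m a v => if growing (v 0) a m.+1 then a else m.+1));
    computable.
  by apply: cf_if; computable; apply: cp_growing; computable.
by apply: (cf_comp (gs := fun i v => nth 0 [:: s v; l v] i) H) => -[|[]].
Qed.

Lemma cf_block k s l : computable_fun k s -> computable_fun k l ->
  computable_fun k (fun v => block (s v) (l v)).
Proof.
move=> Hs Hl.
have H : computable_fun 2 (fun v => block (v 0) (v 1)).
  apply: (cf_rec (f := fun=> 0) (g := fun m r v => r + (start (v 0) m.+1 == m.+1)));
    computable.
  by apply: cf_start; computable.
by apply: (cf_comp (gs := fun i v => nth 0 [:: s v; l v] i) H) => -[|[]].
Qed.

Lemma cp_colour : computable_pred 2 (fun v => colour (v 0) (v 1)).
Proof.
have Hb : computable_fun 2 (fun v => block (v 0) (v 1)) by apply: cf_block; computable.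
pose p v := exb (v 0).+1 (fun j => exb (v 0).+1 (fun y =>
    (v 0 == npair (j + j) y) && bitat j (v 1) || (v 0 == npair (j + j).+1 y)
      && ~~ bitat j (v 1))).
have Hp : computable_pred 2 p by rewrite /p; computable; apply: cp_bitat; computable.
by apply: (cp_subst (gs := fun i v => if i is 0 then block (v 0) (v 1) else v 1) Hp)
  => -[|[|]] // _; computable.
Qed.

Definition grows x l := exists2 e, e <= x & (exists s, halts e x s) /\ ~~ halts e x l.

Lemma eventually_all n (P : nat -> nat -> Prop) :
  (forall e, e < n -> exists s0, forall s, s0 <= s -> P e s) ->
  exists s0, forall s, s0 <= s -> forall e, e < n -> P e s.
Proof.
elim: n => [|n IH] H; first by exists 0.
have [|s0 H0] := IH; first by move=> e lt; apply: H; lia.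
have [s1 H1] := H n (ltnSn n).
exists (maxn s0 s1) => s le e; rewrite ltnS leq_eqVlt => /orP[/eqP->|lt].
  by apply: H1; lia.
by apply: H0 => //; lia.
Qed.

(** Only programs up to [x] matter, and whether one is known to halt changes at most once as the
    stage grows. *)
Lemma growing_lim x l : exists s0, forall s, s0 <= s -> growing s x l = `[< grows x l >].
Proof.
have [|s0 H0] := @eventually_all x.+1 (fun e s => halts e x s = `[< exists s', halts e x s' >]).
  move=> e _; case: (pselect (exists s, halts e x s)) => [[s Hs]|N].
    exists s => s' le; rewrite (halts_mono le Hs); apply/esym/asboolP.
    by exists s.
  by exists 0 => s _; apply/idP/asboolP => [Hs|//]; exists s.
exists s0 => s le; apply/exbP/asboolP.
  move=> [e lt /andP[]]; rewrite (H0 s le e lt) => /asboolP H N.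
  by exists e.
move=> [e lt [H N]]; exists e => //; rewrite (H0 s le) // N andbT.
by apply/asboolP.
Qed.

Fixpoint lim_start l :=
  if l is m.+1 then (if `[< grows (lim_start m) m.+1 >] then lim_start m else m.+1) else 0.

Fixpoint lim_block l :=
  if l is m.+1 then lim_block m + (lim_start m.+1 == m.+1) else 0.

Lemma start_lim l : exists s0, forall s, s0 <= s -> start s l = lim_start l.
Proof.
elim: l => [|l [s0 H0]]; first by exists 0.
have [s1 H1] := growing_lim (lim_start l) l.+1.
exists (maxn s0 s1) => s le; rewrite /start /= -/(start s l) H0; last lia.
by rewrite H1 //; lia.
Qed.

Lemma block_lim l : exists s0, forall s, s0 <= s -> block s l = lim_block l.
Proof.
elim: l => [|l [s0 H0]]; first by exists 0.
have [s1 H1] := start_lim l.+1.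
exists (maxn s0 s1) => s le; rewrite /block /= -/(block s l) H0; last lia.
by rewrite (H1 s) //; lia.
Qed.

Definition lim_colour c : bool :=
  `[< exists j y, lim_block c = npair (j + j) y /\ bitat j c \/
                  lim_block c = npair (j + j).+1 y /\ ~~ bitat j c >].

Lemma colour_lim c : exists s0, forall s, s0 <= s -> colour s c = lim_colour c.
Proof.
have [s0 H0] := block_lim c; exists s0 => s /H0 E; rewrite /colour E.
apply/exbP/asboolP.
  move=> [j _ /exbP[y _ /orP[]/andP[/eqP-> b]]]; exists j, y; [by left|by right].
move=> [j [y H]]; exists j; first by rewrite /npair in H; case: H => -[] -> _; nia.
apply/exbP; exists y; first by rewrite /npair in H; case: H => -[] -> _; nia.
by case: H => -[-> ->]; rewrite eqxx ?orbT.
Qed.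

(** The easy half of the limit lemma: one relation, the colour at stage [b + c], serves for both
    quantifier forms because the stages stabilise. *)
Lemma delta02_lim_colour : Delta02 (fun s => lim_colour (code s)).
Proof.
pose R a b c := colour (b + c) a.
have HR : computable_rel3 R.
  have [e He] : computable_pred 3 (fun v => R (v 0) (v 1) (v 2)).
    apply: (cp_subst (gs := fun i v => if i is 0 then v 1 + v 2 else v 0) cp_colour)
      => -[|[|]] // _; computable.
  by exists e => a b c; apply: (He (fun i => nth 0 [:: a; b; c] i)).
split; exists R; split=> // s; have [s0 H0] := colour_lim (code s).
  split=> [H|[x H]]; first by exists s0 => y; rewrite /R H0 //; lia.
  by rewrite -(H0 (x + s0)) ?H //; [apply: H | lia].
split=> [H x|H]; first by exists s0; rewrite /R H0 //; lia.
by have [y] := H s0; rewrite /R H0 //; lia.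
Qed.

Lemma lim_block_le l : lim_block l <= l.
Proof. by elim: l => //= l IH; case: eqP => _; lia. Qed.

(** Finitely many programs are considered, and those that halt do so by a common time; hence every
    block is finite. *)
Lemma growsP_bounded x : exists l0, forall l, l0 <= l -> ~ grows x l.
Proof.
have [|l0 H0] := @eventually_all x.+1 (fun e l => (exists s, halts e x s) -> halts e x l).
  move=> e _; case: (pselect (exists s, halts e x s)) => [[s Hs]|N].
    by exists s => s' le _; apply: halts_mono Hs.
  by exists 0 => s _.
by exists l0 => l le [e lt [H]]; rewrite (H0 l le).
Qed.

Lemma lim_start_grows a m :
  lim_start a = a -> (forall l, a < l <= a + m -> grows a l) ->
  lim_start (a + m) = a /\ lim_block (a + m) = lim_block a.
Proof.
move=> sa; elim: m => [|m IH] G; first by rewrite addn0.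
have [|E1 E2] := IH; first by move=> l ?; apply: G; lia.
rewrite addnS /= E1 E2 asboolT; last by rewrite -addnS; apply: G; lia.
by split=> //; case: eqP; lia.
Qed.

(** After a block starting at [a], the next one begins at the least later point where [grows a]
    fails. *)
Lemma block_start k : exists a, lim_start a = a /\ lim_block a = k.
Proof.
elim: k => [|k [a [sa ba]]]; first by exists 0.
have ex : exists m, ~~ `[< grows a (a + m.+1) >].
  have [l0 H] := growsP_bounded a; exists l0; apply/asboolPn.
  by apply: H; lia.
case: (ex_minnP ex) => m /asboolPn N min.
have [|E1 E2] := @lim_start_grows a m sa.
  move=> l lel; case: (pselect (grows a l)) => // N'.
  have := min (l - a).-1; rewrite (_ : a + _ = l); last lia.
  by move=> H; have := H (introT (asboolPn _) N'); lia.
exists (a + m.+1); rewrite addnS /= E1 E2 asboolF -?addnS // eqxx ba addn1.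
by [].
Qed.

(** Let [e] compute [h]. The block numbered [npair (j + j + b) (prf_code e)] starts at some [a] not
    below [prf_code e], as no block starts before its own number. So [e] is among the programs the
    block waits for, and the block extends past [h a]. *)
Lemma lim_colour_block (h : nat -> nat) j (b : bool) : computable_fun 1 (fun v => h (v 0)) ->
  exists n, forall c, n <= c <= h n -> lim_colour c = bitat j c (+) b.
Proof.
move=> [e He].
pose k := npair (j + j + b) (prf_code e).
have [a [sa ba]] := block_start k.
have lea : prf_code e <= a.
  by have := lim_block_le a; rewrite ba /k /npair; nia.
exists a => c /andP[le1 le2].
have [u Hu] := run_complete (He (fun=> a)).
have ex : exists u, halts (prf_code e) a u.
  exists (maxn u (h a).+1); apply/exbP; exists (h a); first lia.
  by apply: run_mono Hu => [|x _]; [lia | rewrite bit0].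
have big u' : halts (prf_code e) a u' -> h a < u'.
  move=> /exbP[r lt H].
  suff -> : h a = r by [].
  apply: peval_det (He (fun=> a)) _; apply: (@run_sound u').
  by move: H; apply: run_mono => // x _; rewrite bit0.
have [|_] := @lim_start_grows a (c - a) sa.
  move=> l lel; exists (prf_code e) => //; split=> //.
  by apply/negP => /big; lia.
rewrite subnKC // ba => Eb.
apply/asboolP/idP => [[j' [y]]|H].
  rewrite Eb /k => -[[/npair_inj[]]|[/npair_inj[]]]; case: b {k ba Eb} => E1 _ H.
  - lia.
  - by rewrite addbF (_ : j = j') //; lia.
  - by rewrite addbT (_ : j = j') //; lia.
  - lia.
exists j, (prf_code e); rewrite Eb /k; case: b {k ba Eb} H => /= H; [right|left].
  by rewrite addn1 -addbT.
by rewrite addn0 -(addbF (bitat _ _)).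
Qed.

(** * The forcing *)

Lemma dependent_choice (T : Type) (P : nat -> T -> Prop) (R : nat -> T -> T -> Prop) (x0 : T) :
  P 0 x0 -> (forall n x, P n x -> exists y, P n.+1 y /\ R n x y) ->
  exists f : nat -> T, f 0 = x0 /\ forall n, P n (f n) /\ R n (f n) (f n.+1).
Proof.
move=> P0 step.
have H (z : nat * T) : exists y, P z.1 z.2 -> P z.1.+1 y /\ R z.1 z.2 y.
  case: z => n x /=; case: (pselect (P n x)) => [/step[y Hy]|N]; first by exists y.
  by exists x0.
have [g Hg] := choice H.
pose f := fix f n := if n is m.+1 then g (m, f m) else x0.
have Pf n : P n (f n) by elim: n => //= n /(Hg (n, _))[].
by exists f; split=> // n; split=> //; case: (Hg (n, f n) (Pf n)).
Qed.

(** The path runs through the finite segments that have extensions at every level; branching is over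
    pairs of bits, so two sets are built together. *)
Lemma konig (P : nat -> (nat -> bool * bool) -> Prop) :
  (forall u W W', (forall x, x < u -> W x = W' x) -> P u W -> P u W') ->
  (forall u W, P u.+1 W -> P u W) ->
  (forall u, exists W, P u W) -> exists W, forall u, P u W.
Proof.
move=> use mono ex.
have mono' u u' W : u <= u' -> P u' W -> P u W.
  by move=> /subnK <-; elim: (u' - u) => //= k IH /mono.
pose Ext n W := forall u, exists2 W', P u W' & forall x, x < n -> W' x = W x.
have [W0 _] := ex 0.
have [||f [_ Hf]] := @dependent_choice _ Ext (fun n W W' => forall x, x < n -> W' x = W x) W0.
- by move=> u; have [W PW] := ex u; exists W.
- move=> n W E.
  pose upd ab x := if x == n then ab else W x.
  suff [ab Hab] : exists ab, Ext n.+1 (upd ab).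
    by exists (upd ab); split=> // x lt; rewrite /upd; case: eqP => //; lia.
  apply: contrapT => N.
  have H ab : exists u, forall W', P u W' -> ~ (forall x, x < n.+1 -> W' x = upd ab x).
    apply: contrapT => N'; apply: N; exists ab => u.
    apply: contrapT => N; apply: N'; exists u => W' PW' H.
    by apply: N; exists W'.
  have [g Hg] := choice H.
  (* If all four values at [n] failed, each from its own level on, an extension reaching the largest
     of these levels would contradict the failure of the value it takes. *)
  have [W' PW' EW'] := E (maxn (maxn (g (true, true)) (g (true, false)))
                               (maxn (g (false, true)) (g (false, false)))).
  apply: (Hg (W' n) W').
    by apply: mono' PW'; case: (W' n) => -[] []; lia.
  move=> x lt; rewrite /upd; case: eqP => [-> //|ne]; apply: EW'; lia.
have agree n m x : x < n -> n <= m -> f m x = f n x.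
  move=> lt /subnK <-; elim: (m - n) => //= k <-; rewrite addSn.
  by apply: (Hf _).2; lia.
exists (fun x => f x.+1 x) => u.
have [W' PW' E] := (Hf u).1 u.
apply: use PW' => x lt; rewrite E //.
by rewrite (@agree x.+1 u).
Qed.

(** A tree without a path has an empty level, and emptiness of a level is a check of finitely many
    masks; hence such a level is found by search. *)
Lemma compact_bound (P : nat -> nat -> (nat -> bool) -> (nat -> bool) -> bool) :
  computable_pred 4 (fun v => P (v 0) (v 1) (bit (v 2)) (bit (v 3))) ->
  (forall n u Y Y' Z Z', (forall x, x < u -> Y x = Y' x) -> (forall x, x < u -> Z x = Z' x) ->
     P n u Y Z -> P n u Y' Z') ->
  (forall n u Y Z, P n u.+1 Y Z -> P n u Y Z) ->
  (forall n, ~ exists Y Z, forall u, P n u Y Z) ->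
  exists m, computable_fun 1 (fun v => m (v 0)) /\ forall n Y Z, ~~ P n (m n) Y Z.
Proof.
move=> HP use mono none.
have bm Y u x : x < u -> Y x = bit (bitmask Y u) x by rewrite bit_bitmask => ->.
pose p n u := allb (2 ^ u) (fun y => allb (2 ^ u) (fun z => ~~ P n u (bit y) (bit z))).
have [||m [Hm pm]] := @unbounded_search p.
- rewrite /p; computable.
  apply: (cp_subst (gs := fun i v => nth 0 [:: v 2; v 3; v 1; v 0] i) HP) => -[|[|[|[|]]]] //= _;
    computable.
- move=> n; apply: contrapT => N; apply: (none n).
  have [|||W HW] := @konig (fun u W => P n u (fun x => (W x).1) (fun x => (W x).2)).
  + by move=> u W W' E; apply: use => x /E ->.
  + by move=> u W; apply: mono.
  + move=> u; apply: contrapT => N'; apply: N; exists u.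
    apply/allbP => y _; apply/allbP => z _; apply/negP => H; apply: N'.
    by exists (fun x => (bit y x, bit z x)).
  + by exists (fun x => (W x).1), (fun x => (W x).2).
exists m; split=> // n Y Z; apply/negP => H.
have := pm n; rewrite /p => /allbP/(_ _ (bitmask_lt Y _))/allbP/(_ _ (bitmask_lt Z _))/negP;
  apply.
by apply: use H; apply: bm.
Qed.

(** Read [out u Y s] as: with oracle [Y], the code [s] is printed by stage [u], with queries below
    [u]. The notion is abstract because an artificial functional is needed later besides actual
    programs. *)
Definition admissible (out : nat -> (nat -> bool) -> nat -> bool) :=
  computable_pred 3 (fun v => out (v 0) (bit (v 1)) (v 2)) /\
  forall u u' Y Y' s, u <= u' -> (forall x, x < u -> Y x = Y' x) -> out u Y s -> out u' Y' s.

Section Silent.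
Variables (out : nat -> (nat -> bool) -> nat -> bool) (f N j : nat) (b : bool).
Hypothesis adm : admissible out.

(* The mask e runs over the finite oracles that agree with f below N and are
   contained in X from N on. *)
Definition silent n u (X : nat -> bool) :=
  allb (2 ^ u) (fun e =>
    allb u (fun x => ((x < N) ==> (bit e x == bit f x)) &&
                     ((N <= x) ==> (bit e x ==> X x))) ==>
    allb u (fun s => (n < s) && (bitat j s == b) ==> ~~ out u (bit e) s)).

Lemma silentP n u X :
  silent n u X <->
  (forall E, (forall x, x < u -> x < N -> E x = bit f x) ->
     (forall x, x < u -> N <= x -> E x -> X x) ->
     forall s, s < u -> n < s -> bitat j s = b -> ~~ out u E s).
Proof.
split=> [/allbP H E Ef EX s su ns bs|H].
  have /implyP Hs := H _ (bitmask_lt E u).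
  have /Hs/allbP/(_ s su) : allb u (fun x =>
      ((x < N) ==> (bit (bitmask E u) x == bit f x)) &&
      ((N <= x) ==> (bit (bitmask E u) x ==> X x))).
    apply/allbP => x lt; rewrite bit_bitmask lt /=; apply/andP; split.
      by apply/implyP => lt'; rewrite Ef.
    by apply/implyP => le; apply/implyP; apply: EX.
  rewrite ns bs eqxx /=; apply: contra; apply: adm.2 => // x lt.
  by rewrite bit_bitmask lt.
apply/allbP => e _; apply/implyP => /allbP He; apply/allbP => s su.
apply/implyP => /andP[ns /eqP bs]; apply: H => // x lt.
  by move=> xN; have := He x lt; rewrite xN leqNgt xN andbT /= => /eqP.
by move=> Nx; have := He x lt; rewrite ltnNge Nx /= => /implyP.
Qed.

Lemma silent_sub n u u' (X X' : nat -> bool) : u <= u' -> (forall x, x < u -> X x -> X' x) ->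
  silent n u' X' -> silent n u X.
Proof.
move=> le XX /silentP H; apply/silentP => E Ef EX s su ns bs.
(* From [u] on, the oracle is continued by [f] up to [N] and by nothing afterwards, so it still
   meets the constraints at the larger level. *)
pose E' x := if x < u then E x else (x < N) && bit f x.
apply: contra (H E' _ _ s _ ns bs) => [|x lt xN|x lt Nx|]; last lia.
- by apply: adm.2 => // x lt; rewrite /E' lt.
- by rewrite /E'; case: ifP => [xu|_]; [apply: Ef | rewrite xN].
- rewrite /E'; case: ifP => [xu /(EX x xu Nx)|_]; first exact: XX.
  by rewrite ltnNge Nx.
Qed.

Lemma silent_all n (X E : nat -> bool) :
  (forall u, silent n u X) -> (forall x, x < N -> E x = bit f x) ->
  (forall x, N <= x -> E x -> X x) ->
  forall u s, n < s -> bitat j s = b -> ~~ out u E s.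
Proof.
move=> H Ef EX u s ns bs; apply/negP => o.
have /negP := (silentP n (maxn u s.+1) X).1 (H _) E (fun x _ => Ef x) (fun x _ => EX x) s
  ltac:(lia) ns bs.
by apply; apply: adm.2 o => //; lia.
Qed.

Lemma cp_out k u y s : computable_fun k u -> computable_fun k y -> computable_fun k s ->
  computable_pred k (fun v => out (u v) (bit (y v)) (s v)).
Proof.
move=> Hu Hy Hs.
by apply: (cp_subst (gs := fun i v => nth 0 [:: u v; y v; s v] i) adm.1) => -[|[|[]]].
Qed.

Lemma cp_silent k (n u : env -> nat) (X : env -> nat -> bool) :
  computable_fun k n -> computable_fun k u ->
    computable_pred k.+2 (fun w => X (fun i => w i.+2) (w 0)) ->
  computable_pred k (fun v => silent (n v) (u v) (X v)).
Proof.
move=> Hn Hu HX.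
have lift g : computable_fun k g -> computable_fun k.+1 (fun w => g (fun i => w i.+1)).
  by move=> Hg; apply: (cf_comp (gs := fun i w => w i.+1) Hg) => i lt; apply: cf_var.
have lift2 g : computable_fun k g -> computable_fun k.+2 (fun w => g (fun i => w i.+2)).
  by move=> Hg; apply: (cf_comp (gs := fun i w => w i.+2) Hg) => i lt; apply: cf_var.
rewrite /silent; computable; try exact: lift; try exact: lift2.
- by apply: cp_bitat; computable.
- by apply: cp_out; computable; apply: lift2.
Qed.
End Silent.

(** * Forcing conditions and the dichotomy *)

Section Forcing.
Variable B : nat -> bool.

(** [part i] is the finite set built on side [i], decided below [stem]; [cls u Y] says that [Y] is
    not excluded from the class by level [u]; [gap] bounds the search for the next element of a
    reservoir. *)
Record condition := Condition {
  part : bool -> nat -> bool;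
  stem : nat;
  cls : nat -> (nat -> bool) -> bool;
  gap : nat -> nat }.

(** Below the stem a reservoir consists of both parts, so that closure under subsets brings each
    part into the class. *)
Definition reservoir c (Y : nat -> bool) :=
  [/\ forall u, cls c u Y,
      forall x, x < stem c -> Y x = part c true x || part c false x &
      forall m, stem c <= m -> exists2 x, m <= x < gap c m & Y x].

Definition class_ok (K : nat -> (nat -> bool) -> bool) :=
  computable_pred 2 (fun v => K (v 0) (bit (v 1))) /\
  forall u u' (Y Y' : nat -> bool), u <= u' -> (forall x, x < u -> Y x -> Y' x) -> K u' Y' ->
    K u Y.

(** The arbitrary set [B] constrains only the finite parts; the class and the gap bound stay
    effective. *)
Record wf c : Prop := Wf {
  wf_part : forall i x, part c i x -> x < stem c /\ B x = i;
  wf_cls : class_ok (cls c);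
  wf_gap : computable_fun 1 (fun v => gap c (v 0));
  wf_reservoir : exists Y, reservoir c Y }.

Definition extends c' c :=
  [/\ stem c <= stem c', forall i x, x < stem c -> part c' i x = part c i x &
      forall Y, (forall u, cls c' u Y) -> forall u, cls c u Y].

Lemma extends_trans c1 c2 c3 : extends c3 c2 -> extends c2 c1 -> extends c3 c1.
Proof.
move=> [s32 p32 k32] [s21 p21 k21]; split=> [|i x lt|Y /k32/k21 //]; first lia.
by rewrite p32 ?p21 //; lia.
Qed.

Lemma part_stem c i x : wf c -> stem c <= x -> part c i x = false.
Proof. by move=> W le; apply/negP => /(wf_part W)[]; lia. Qed.

Lemma class_setI K K' : class_ok K -> class_ok K' -> class_ok (fun u Y => K u Y && K' u Y).
Proof.
move=> [c1 m1] [c2 m2]; split; first by computable.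
by move=> u u' Y Y' le YY /andP[H1 H2]; apply/andP; split; [apply: m1 H1 | apply: m2 H2].
Qed.

Section Key.
Variables (c : condition) (out : bool -> nat -> (nat -> bool) -> nat -> bool) (a : bool ->
  bool) (j : nat) (b : bool).
Hypothesis Wc : wf c.
Hypothesis adm : forall i, admissible (out i).

Let N := stem c.
Let quiet i := silent (out i) (bitmask (part c i) N) N j (b (+) a i).

Let stem_mask := bitmask (fun x => part c true x || part c false x) N.

(** Level [u] of a class of pairs: [Y] is a reservoir, [Z] splits it into two sides, and each side
    [i] prints no code above [n] with bit [b (+) a i] at position [j]. *)
Let tree n u (Y Z : nat -> bool) :=
  [&& cls c u Y, allb u (fun x => (x < N) ==> (Y x == bit stem_mask x)),
      allb u (fun m => (N <= m) && (gap c m <= u) ==>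
        exb u (fun x => [&& m <= x, x < gap c m & Y x])),
      quiet false n u (fun x => Y x && (Z x == false)) &
      quiet true n u (fun x => Y x && (Z x == true))].

Lemma tree_use n u Y Y' Z Z' :
  (forall x, x < u -> Y x = Y' x) -> (forall x, x < u -> Z x = Z' x) ->
  tree n u Y Z -> tree n u Y' Z'.
Proof.
move=> YY ZZ /and5P[H1 /allbP H2 /allbP H3 H4 H5]; apply/and5P; split.
- by apply: (wf_cls Wc).2 H1 => // x lt; rewrite YY.
- by apply/allbP => x lt; rewrite -YY //; apply: H2.
- apply/allbP => m lt; apply/implyP => H; have /implyP/(_ H) := H3 m lt.
  by apply: exb_mono => // x xu; rewrite YY.
- by apply: (silent_sub (adm _)) H4 => // x lt; rewrite YY // ZZ.
- by apply: (silent_sub (adm _)) H5 => // x lt; rewrite YY // ZZ.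
Qed.

Lemma tree_mono n u Y Z : tree n u.+1 Y Z -> tree n u Y Z.
Proof.
move=> /and5P[H1 /allbP H2 /allbP H3 H4 H5]; apply/and5P; split.
- exact: (wf_cls Wc).2 H1.
- by apply/allbP => x lt; apply: H2; lia.
- apply/allbP => m lt; apply/implyP => /andP[H H'].
  have /implyP/(_ _)/exbP[|x xu /and3P[mx xg Yx]] := H3 m ltac:(lia); first by apply/andP; lia.
  by apply/exbP; exists x; [lia | rewrite mx xg].
- exact: (silent_sub (adm _)) H4.
- exact: (silent_sub (adm _)) H5.
Qed.

Lemma cp_tree k (n u y z : env -> nat) : computable_fun k n -> computable_fun k u ->
  computable_fun k y -> computable_fun k z ->
  computable_pred k (fun v => tree (n v) (u v) (bit (y v)) (bit (z v))).
Proof.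
move=> Hn Hu Hy Hz.
have H : computable_pred 4 (fun v => tree (v 0) (v 1) (bit (v 2)) (bit (v 3))).
  have [HK _] := wf_cls Wc; have Hg := wf_gap Wc.
  rewrite /tree; computable.
  - by apply: (cp_subst (gs := fun i v => if i is 0 then v 1 else v 2) HK) => -[|[|]] // _;
      computable.
  - by apply: (cf_comp1 Hg); computable.
  - by apply: (cf_comp1 Hg); computable.
  - by apply: (@cp_silent _ _ _ _ _ (adm _) _ _ _ (fun v x => bit (v 2) x && (bit (v 3)
      x == false)));
      computable.
  - by apply: (@cp_silent _ _ _ _ _ (adm _) _ _ _ (fun v x => bit (v 2) x && (bit (v 3)
      x == true)));
      computable.
by apply: (cp_subst (gs := fun i v => nth 0 [:: n v; u v; y v; z v] i) H) => -[|[|[|[]]]].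
Qed.

Lemma tree_reservoir n Y Z : (forall u, tree n u Y Z) -> reservoir c Y.
Proof.
move=> H; split=> [u|x lt|m le].
- by have /and5P[] := H u.
- have /and5P[_ /allbP/(_ x (ltnSn x))] := H x.+1.
  by rewrite -/N in lt; rewrite lt /= bit_bitmask lt => /eqP ->.
(* The level is chosen so large that the gap clause at [m] is actually tested. *)
- have /and5P[_ _ /allbP/(_ m ltac:(lia))/implyP G _ _] := H (maxn m.+1 (gap c m)).
  have /G/exbP[x _ /and3P[mx xg Yx]] : (N <= m) && (gap c m <= maxn m.+1 (gap c m)).
    by rewrite /N le leq_maxr.
  by exists x; rewrite ?mx.
Qed.

Lemma reservoir_tree n Y Z u : reservoir c Y ->
  quiet false n u (fun x => Y x && (Z x == false)) ->
  quiet true n u (fun x => Y x && (Z x == true)) -> tree n u Y Z.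
Proof.
move=> [RK RD Rg] H4 H5; apply/and5P; split=> //.
- apply/allbP => x lt; apply/implyP => xN.
  by rewrite RD // bit_bitmask xN.
- apply/allbP => m lt; apply/implyP => /andP[/Rg[x /andP[mx xg] Yx] gu].
  by apply/exbP; exists x; [lia | rewrite mx xg].
Qed.

(** One of two ways to defeat side [i]: large outputs with the chosen bit are excluded for good. The
    other is [errs]: an output of the wrong colour is secured by the stem. *)
Definition avoids c' i := exists n, forall X E : nat -> bool,
  (forall u, cls c' u X) -> (forall x, x < stem c -> E x = part c i x) ->
  (forall x, stem c <= x -> E x -> X x) ->
  forall u s, n < s -> bitat j s = b (+) a i -> ~~ out i u E s.

Definition errs c' i := exists s u,
  [/\ u <= stem c', out i u (part c' i) s & lim_colour s = ~~ a i].

Let quiet_cls i n u Y := cls c u Y && quiet i n u Y.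

Lemma class_quiet i n : class_ok (quiet_cls i n).
Proof.
apply: class_setI; first exact: wf_cls.
split; last by move=> u u' Y Y' le YY; apply: (silent_sub (adm _)).
by apply: (@cp_silent _ _ _ _ _ (adm _) _ _ _ (fun v => bit (v 1))); computable.
Qed.

Lemma avoids_quiet c' i n : cls c' = quiet_cls i n -> avoids c' i.
Proof.
move=> E; exists n => X F; rewrite E => XK XF XX u s ns bs.
apply: (silent_all (adm i) (n := n) (X := X) (f := bitmask (part c i) N) (N := N)) ns bs => //.
  by move=> u'; have /andP[] := XK u'.
by move=> x lt; rewrite bit_bitmask lt XF.
Qed.

(* X is one side of a splitting of the reservoir Y; it takes over beyond the stem. *)
Lemma quiet_extension i n N' g (X Y : nat -> bool) :
  reservoir c Y -> N <= N' -> computable_fun 1 (fun v => g (v 0)) ->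
  (forall x, X x -> Y x) -> (forall u, quiet i n u X) ->
  (forall m, N' <= m -> exists2 x, m <= x < g m & X x) ->
  exists c', [/\ wf c', extends c' c & avoids c' i].
Proof.
move=> [RK RD Rg] le Hg XY QX inf.
exists (Condition (part c) N' (quiet_cls i n) g); split.
- split=> //=.
  + by move=> i' x /(wf_part Wc)[]; rewrite -/N; split=> //; lia.
  + exact: class_quiet.
  pose Y' x := if x < N' then part c true x || part c false x else X x.
  have sub x : Y' x -> Y x.
    rewrite /Y'; case: ifP => [_|_ /XY //] H.
    by rewrite RD //; case/orP: H => /(wf_part Wc)[].
  exists Y'; split=> /= [u|x lt|m lem].
  + apply/andP; split; first by apply: (wf_cls Wc).2 (RK u) => // x _; apply: sub.
    apply: (silentP _ _ _ _ (adm i) _ _ _).2 => E Ef EY s su ns bs.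
    apply: (silentP _ _ _ _ (adm i) _ _ _).1 (QX u) _ Ef _ _ su ns bs => x xu xN Ex.
    move: (EY x xu xN Ex); rewrite /Y'; case: ifP => // _.
    by rewrite !part_stem.
  + by rewrite /Y' lt.
  + by have [x H Xx] := inf m lem; exists x => //; rewrite /Y' ltnNge (leq_trans lem) //;
      case/andP: H.
- by split=> //= Y' H u; have /andP[] := H u.
- by apply: (@avoids_quiet _ _ n).
Qed.

(** If some quiet splitting has a finite false side, its true side inherits the old gap bound from
    some point on. Otherwise the false side is infinite in all quiet splittings, and compactness
    turns this into a computable gap bound. *)
Lemma quiet_case n Y Z : (forall u, tree n u Y Z) ->
  exists c' i, [/\ wf c', extends c' c & avoids c' i].
Proof.
move=> TYZ.
have quietT Y' Z' i : (forall u, tree n u Y' Z') ->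
  forall u, quiet i n u (fun x => Y' x && (Z' x == i)).
  by move=> T u; have /and5P[_ _ _] := T u; case: i.
have [[Y' [Z' [M [T fin]]]]|inf] := pselect (exists Y Z M, (forall u, tree n u Y Z) /\
    forall x, M <= x -> ~~ (Y x && (Z x == false))).
  have [|||||c' [W E A]] := @quiet_extension true n (maxn N M) (gap c)
    (fun x => Y' x && (Z' x == true)) Y' (tree_reservoir T).
  - lia.
  - exact: wf_gap.
  - by move=> x /andP[].
  - exact: quietT.
  - move=> m lem; have [_ _ Rg] := tree_reservoir T.
    have [|x H Yx] := Rg m; first by rewrite -/N; lia.
    exists x => //; have := fin x; rewrite Yx /=; case: (Z' x) => // G.
    by have := G ltac:(lia).
  - by exists c', true.
pose P m u Y Z := tree n u Y Z && ~~ exb u (fun x => [&& m <= x, Y x & Z x == false]).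
have [||||g [Hg Pg]] := @compact_bound P.
- rewrite /P; computable; apply: (@cp_tree 4 (fun=> n)); computable.
- move=> m u Y1 Y2 Z1 Z2 YY ZZ /andP[T]; rewrite /P (tree_use YY ZZ T) /=.
  by apply: contra; apply: exb_mono => // x lt; rewrite YY ?ZZ.
- move=> m u Y1 Z1 /andP[T]; rewrite /P (tree_mono T) /=.
  by apply: contra; apply: exb_mono.
- move=> m [Y1 [Z1 H]]; apply: inf; exists Y1, Z1, m; split=> [u|x le].
    by have /andP[] := H u.
  apply/negP => /andP[Yx Zx]; have /andP[_ /negP] := H x.+1; apply.
  by apply/exbP; exists x => //; rewrite le Yx.
have [|||||c' [W E A]] := @quiet_extension false n N g
    (fun x => Y x && (Z x == false)) Y (tree_reservoir TYZ) => //.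
- by move=> x /andP[].
- exact: quietT.
- move=> m _; have := Pg m Y Z; rewrite /P TYZ /= negbK => /exbP[x lt /and3P[le Yx Zx]].
  by exists x; rewrite ?le ?Yx.
- by exists c', false.
Qed.

(** The question is whether quiet splittings exist for some [n]. If not, the computable bound [h]
    holds for all splittings, hence also for the one by [B], which need not be computable. *)
Lemma key : exists c' i, [/\ wf c', extends c' c & errs c' i \/ avoids c' i].
Proof.
have [[n [Y [Z T]]]|none] := pselect (exists n Y Z, forall u, tree n u Y Z).
  by have [c' [i [W E A]]] := quiet_case T; exists c', i; split=> //; right.
have [||||h [Hh Th]] := @compact_bound tree.
- by apply: cp_tree; computable.
- exact: tree_use.
- exact: tree_mono.
- by move=> n [Y [Z T]]; apply: none; exists n, Y, Z.
(* On a block of kind [(j, ~~ b)] the bit [b (+) a i] gives the colour [~~ a i], which is wrong for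
   either side. *)
have [n An] := lim_colour_block j (~~ b) Hh.
have [Y RY] := wf_reservoir Wc; have [RK RD Rg] := RY.
have [i Ni] : exists i, ~~ quiet i n (h n) (fun x => Y x && (B x == i)).
  apply: contrapT => N0; have /negP := Th n Y B; apply.
  by apply: reservoir_tree => //; apply: contrapT => /negP H; apply: N0;
    [exists false|exists true].
pose u := h n.
have [E [Ef EY [s [[su ns bs] o]]]] : exists E : nat -> bool,
    [/\ (forall x, x < u -> x < N -> E x = part c i x),
        (forall x, x < u -> N <= x -> E x -> Y x && (B x == i)) &
        exists s, [/\ s < u, n < s & bitat j s = b (+) a i] /\ out i u E s].
  apply: contrapT => N0; move/negP: Ni; apply;
    apply: (silentP _ _ _ _ (adm i) _ _ _).2 => E Ef EY s su ns bs.
  apply/negP => o; apply: N0; exists E; split=> //; last by exists s.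
  by move=> x xu xN; rewrite Ef // bit_bitmask xN.
pose N' := maxn N u.
(* Only side [i] absorbs the finite oracle [E]; the other part is unchanged, while the stem moves
   past the use [u]. *)
pose F' i' x := if x < N then part c i' x else [&& i' == i, x < u & E x].
have subF i' x : N <= x -> F' i' x -> [/\ i' = i, x < u, Y x & B x = i].
  by move=> le; rewrite /F' ltnNge le => /and3P[/eqP-> xu /(EY x xu le)/andP[Yx /eqP]].
pose Y' x := if x < N' then F' true x || F' false x else Y x.
have sub x : Y' x -> Y x.
  rewrite /Y'; case: ifP => // _; case: (ltnP x N) => [lt|le].
    by rewrite /F' lt RD.
  by case/orP => /(subF _ _ le)[].
exists (Condition F' N' (cls c) (gap c)), i; split.
- split=> /=; [|exact: wf_cls|exact: wf_gap|].
    move=> i' x; case: (ltnP x N) => [lt|le].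
      by rewrite /F' lt => /(wf_part Wc)[_ ->]; split=> //; rewrite /N'; lia.
    by move=> /(subF _ _ le)[-> xu _ ->]; split=> //; rewrite /N'; lia.
  exists Y'; split=> /= [u'|x lt|m le].
  + by apply: (wf_cls Wc).2 (RK u') => // x _; apply: sub.
  + by rewrite /Y' lt.
  + have [|x H Yx] := Rg m; first by rewrite -/N; move: le; rewrite /N'; lia.
    by exists x => //; rewrite /Y' ltnNge (leq_trans le) //; case/andP: H.
- by split=> //= [|i' x lt]; [rewrite /N' -/N; lia | rewrite /F' lt].
left; exists s, u; split=> /=; first by rewrite /N'; lia.
  apply: (adm i).2 o => // x lt; rewrite /F'; case: ifP => [xN|_]; first exact: Ef.
  by rewrite eqxx lt.
by rewrite (An s) ?bs; [case: (b); case: (a i) | rewrite -/u; lia].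
Qed.
End Key.
End Forcing.

(** * Strings and solution trees *)

Lemma incomparable_bit (s t : seq bool) : ~~ prefix s t -> ~~ prefix t s ->
  exists j, [/\ j < size s, j < size t & nth false s j != nth false t j].
Proof.
elim: s t => [|x s IH] [|y t] //=.
case: (eqVneq x y) => [<-|ne] /=; last by exists 0.
by move=> /IH H /H [j [*]]; exists j.+1.
Qed.

Section SolutionTree.
Variable S : seq bool -> bool.
Hypothesis iso : iso_full_tree S.

Lemma tree_incomparable : exists s t, [/\ S s, S t, ~~ prefix s t & ~~ prefix t s].
Proof.
have [g [gS _ _ gp]] := iso.
exists (g [:: false]), (g [:: true]); split=> //; apply/negP.
  by move=> /(gp [:: false] [:: true]).
by move=> /(gp [:: true] [:: false]).
Qed.

(** The isomorphism sends proper extensions to proper extensions, so lengths increase along a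
    branch. *)
Lemma tree_above s n : S s -> exists t, [/\ S t, prefix s t & n <= size t].
Proof.
have [g [gS gsur ginj gp]] := iso => /gsur[p <-].
elim: n => [|n [t [/gsur[q <-] pq lt]]]; first by exists (g p); rewrite prefix_refl.
exists (g (rcons q true)); split=> //.
  by apply: (prefix_trans pq); apply: (gp _ _).1; rewrite prefix_rcons.
have /prefixP[r E] : prefix (g q) (g (rcons q true)) by apply: (gp _ _).1; rewrite prefix_rcons.
case: r E => [|x r] E; last by rewrite E size_cat /=; lia.
have /ginj/(congr1 size) : g (rcons q true) = g q by rewrite E cats0.
by rewrite size_rcons; lia.
Qed.

Lemma tree_code_above s n : S s -> exists t, [/\ S t, prefix s t & n < code t].
Proof.
move=> /(tree_above n.+1)[t [St st lt]]; exists t; split=> //.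
by have := size_code t; lia.
Qed.
End SolutionTree.

Lemma nth_prefix (s t : seq bool) j : prefix s t -> j < size s -> nth false t j = nth false s j.
Proof. by move=> /prefixP[r ->] lt; rewrite nth_cat lt. Qed.

Definition solves e (H : nat -> bool) (col : bool) := exists S : seq bool -> bool,
  [/\ forall s, peval H e [:: code s] (S s), iso_full_tree S &
      forall s, S s -> lim_colour (code s) = col].

(** * Generic sets and requirements *)

Section Generic.
Variable B : nat -> bool.

Definition below c' c := wf B c' /\ extends c' c.

Lemma below_trans c1 c2 c3 : below c3 c2 -> below c2 c1 -> below c3 c1.
Proof. by move=> [W E] [_ E']; split=> //; apply: extends_trans E E'. Qed.

(** Much weaker than genericity: the conditions for different [n] need not be related to each other.
    Forcing quantifies over all such [H], which avoids a forcing relation on formulas. *)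
Definition limit c i (H : nat -> bool) :=
  forall n, exists c', [/\ below c' c, n <= stem c' & forall x, x < n -> H x = part c' i x].

Lemma limit_below c c' i H : below c' c -> limit c' i H -> limit c i H.
Proof.
move=> b L n; have [c2 [b2 le E]] := L n.
by exists c2; split=> //; apply: below_trans b.
Qed.

Lemma limit_stem c i H x : limit c i H -> x < stem c -> H x = part c i x.
Proof.
move=> /(_ (stem c))[c' [[_ [_ E _]] _ EH]] lt.
by rewrite EH // E.
Qed.

(** Up to [u], [H] is a part of a condition below [c], so it is contained there in a reservoir, and
    the class is closed under subsets. *)
Lemma limit_cls c i H u : wf B c -> limit c i H -> cls c u H.
Proof.
move=> W /(_ u)[c' [[W' [_ _ KK]] le EH]].
have [Y [RK RD _]] := wf_reservoir W'.
apply: (wf_cls W).2 (KK _ RK u) => // x lt.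
rewrite EH // RD; last lia.
by case: i EH => _ ->; rewrite ?orbT.
Qed.

Definition forces c e i col := forall H, limit c i H -> ~ solves e H col.

Definition prints c e i s :=
  exists2 u, u <= stem c & run u (part c i) (prf_code e) (code s) 1.

Lemma prints_below c c' e i s : below c' c -> prints c e i s -> prints c' e i s.
Proof.
move=> [_ [le E _]] [u lu r]; exists u; first lia.
by apply: run_mono r => // x lt; rewrite E //; lia.
Qed.

Lemma prints_sound c e i s H : limit c i H -> prints c e i s -> peval H e [:: code s] 1.
Proof.
move=> L [u lu r]; apply: (@run_sound u).
by apply: run_mono r => // x lt; rewrite (limit_stem L) //; lia.
Qed.

Lemma prints_complete c e i s t H : limit c i H ->
  peval H e [:: code s] 1 -> peval H e [:: code t] 1 ->
  exists c', [/\ below c' c, prints c' e i s & prints c' e i t].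
Proof.
move=> L /run_complete[u Hu] /run_complete[u' Hu'].
have [c' [b le E]] := L (maxn u u').
exists c'; split=> //; [exists u; first lia | exists u'; first lia].
  by apply: run_mono Hu => // x lt; rewrite E //; lia.
by apply: run_mono Hu' => // x lt; rewrite E //; lia.
Qed.

Lemma admissible_run e : admissible (fun u Y s => run u Y (prf_code e) s 1).
Proof.
split; first by apply: cp_run; computable.
by move=> u u' Y Y' s; apply: run_mono.
Qed.

(** An error puts a string of the wrong colour into the solution. In the other case the printed [s]
    belongs to the solution, which has extensions of [s] with arbitrarily large codes; they share
    bit [j] with [s], against [avoids]. *)
Lemma key_forces c c' out a j b e i s : wf B c -> below c' c ->
  out i = (fun u Y s => run u Y (prf_code e) s 1) ->
  prints c e i s -> j < size s -> nth false s j = b (+) a i ->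
  errs out a c' i \/ avoids c out a j b c' i -> forces c' e i (a i).
Proof.
move=> W bc Eo pr js sj H0 H L [S [SH iso Scol]].
have out_S t u : run u H (prf_code e) (code t) 1 -> S t.
  by move=> /run_sound /peval_det/(_ (SH t)); case: (S t).
case: H0 => [[c0 [u [le]]]|[n Av]].
  rewrite Eo; have [t <-] := code_surj c0 => r; apply/eqP.
  have /Scol -> : S t; last by case: (a i).
  apply: (@out_S t u); apply: run_mono r => // x lt.
  by rewrite (limit_stem L) //; lia.
have Ss : S s.
  by have := prints_sound (limit_below bc L) pr => /peval_det/(_ (SH s)); case: (S s).
have [t [St st lt]] := tree_code_above iso n Ss.
have /run_complete[u r] : peval H e [:: code t] 1 by have := SH t; rewrite St.
have := Av H H (fun u => limit_cls u bc.1 L) (fun x => limit_stem (limit_below bc L))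
  _ u (code t) lt.
by rewrite Eo r bitat_code (nth_prefix st js) sj; move=> /(_ (fun _ _ => id) erefl).
Qed.

Lemma not_forces c e i col : ~ forces c e i col -> exists2 H, limit c i H & solves e H col.
Proof.
move=> F; apply: contrapT => N; apply: F => H L sol.
by apply: N; exists H.
Qed.

Lemma solves_prints c e i col : wf B c -> ~ forces c e i col ->
  exists c' s t, [/\ below c' c, prints c' e i s, prints c' e i t & ~~ prefix s t && ~~ prefix
    t s].
Proof.
move=> W /not_forces[H L [S [SH iso _]]].
have [s [t [Ss St st ts]]] := tree_incomparable iso.
have [||c' [b ps pt]] := @prints_complete c e i s t H L.
- by have := SH s; rewrite Ss.
- by have := SH t; rewrite St.
by exists c', s, t; split=> //; rewrite st.
Qed.

Lemma solves_prints_long c e i col n : wf B c -> ~ forces c e i col ->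
  exists c' s, [/\ below c' c, prints c' e i s & n <= size s].
Proof.
move=> W /not_forces[H L [S [SH iso _]]].
have [s [_ [Ss _ _ _]]] := tree_incomparable iso.
have [t [St _ lt]] := tree_above iso n Ss.
have Ht : peval H e [:: code t] 1 by have := SH t; rewrite St.
have [c' [b pt _]] := @prints_complete c e i t t H L Ht Ht.
by exists c', t.
Qed.

Lemma below_refl c : wf B c -> below c c.
Proof. by split. Qed.

(** If neither side can be forced, both can be made to print strings, which supplies the bits that
    the dichotomy requires on each side. *)
Lemma disjunction c (e : bool -> prf) (a : bool -> bool) : wf B c ->
  exists2 c', below c' c & exists i, forces c' (e i) i (a i).
Proof.
move=> W; apply: contrapT => N0.
have N c' i : below c' c -> ~ forces c' (e i) i (a i).
  by move=> b F; apply: N0; exists c' => //; exists i.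
have [c1 [s [t [b1 ps pt /andP[st ts]]]]] := solves_prints W (N c false (below_refl W)).
have [j [js jt ne]] := incomparable_bit st ts.
have [c2 [r [b2 pr jr]]] := solves_prints_long j.+1 b1.1 (N c1 true b1).
have b2c := below_trans b2 b1.
(* The string [r] fixes [b] through side true; since [s] and [t] differ at [j], one of them has the
   bit that side false then needs. *)
pose b := nth false r j (+) a true.
have [q [pq jq qj]] : exists q, [/\ prints c2 (e false) false q, j < size q &
    nth false q j = b (+) a false].
  case: (eqVneq (nth false s j) (b (+) a false)) => [E|ne'].
    by exists s; split=> //; apply: prints_below ps.
  exists t; split=> //; first by apply: prints_below pt.
  by case: (nth _ s j) ne ne'; case: (nth _ t j); case: (b (+) _).
have [c3 [i [W3 E3 K]]] :=
  @key B c2 (fun i u Y s => run u Y (prf_code (e i)) s 1)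
    a j b b2.1 (fun i => admissible_run (e i)).
apply: (N c3 i); first by apply: below_trans b2c.
case: i K => K.
  apply: (key_forces (s := r)) K => //; first exact: b2.1.
  by rewrite /b addbK.
by apply: (key_forces (s := q)) K => //; first exact: b2.1.
Qed.

Lemma add_element c : wf B c -> exists x c',
  [/\ below c' c, stem c <= x & part c' (B x) x].
Proof.
move=> W; have [Y [RK RD Rg]] := wf_reservoir W.
have [x /andP[le _] Yx] := Rg (stem c) (leqnn _).
pose F i y := part c i y || (y == x) && (B x == i).
exists x, (Condition F x.+1 (cls c) (gap c)); split=> //=; last by rewrite /F !eqxx orbT.
split; last first.
  split=> //= [|i y lt]; first lia.
  by rewrite /F (_ : (y == x) = false) ?orbF //; lia.
split=> /=; [|exact: (wf_cls W)|exact: (wf_gap W)|].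
  move=> i y; rewrite /F => /orP[py|/andP[/eqP-> /eqP-> //]].
  by have [lt ->] := wf_part W py; split=> //; lia.
pose Y' y := if y < x.+1 then F true y || F false y else Y y.
have sub y : Y' y -> Y y.
  rewrite /Y' /F; case: ifP => // _; case: eqP => [-> //|_]; rewrite !orbF => H.
  by rewrite RD //; case/orP: H => /(wf_part W)[].
exists Y'; split=> /= [u|y lt|m lem].
- by apply: (wf_cls W).2 (RK u) => // y _; apply: sub.
- by rewrite /Y' lt.
have [|y H Yy] := Rg m; first lia.
by exists y => //; rewrite /Y' ltnNge (leq_trans lem) //; case/andP: H.
Qed.

Lemma generic_set c0 i : wf B c0 ->
  (forall c, below c c0 -> exists x c', [/\ below c' c, stem c <= x & part c' i x]) ->
  (forall c e col, below c c0 -> exists2 c', below c' c & forces c' e i col) ->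
  exists H, [/\ infinite_set H, forall n, H n -> B n = i & forall e col, ~ solves e H col].
Proof.
move=> W grow force.
(* Stage [n] adds an element and meets the requirement coded by [n]; injectivity of the coding
   leaves at most one such requirement. *)
pose R n c c' := [/\ below c' c, exists x, [/\ stem c <= x, x < stem c' & part c' i x] &
  forall e col, npair (prf_code e) (nat_of_bool col) = n -> forces c' e i col].
have [||f [_ Hf]] := @dependent_choice _ (fun _ c => below c c0) R c0.
- exact: below_refl.
- move=> n c b; have [x [c1 [b1 le px]]] := grow c b.
  have b10 := below_trans b1 b.
  have [c2 b2 F2] : exists2 c2, below c2 c1 &
      forall e col, npair (prf_code e) (nat_of_bool col) = n -> forces c2 e i col.
    case: (pselect (exists e col, npair (prf_code e) (nat_of_bool col) = n)) => [[e [col E]]|N].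
      have [c2 b2 F2] := force c1 e col b10; exists c2 => // e' col'.
      by rewrite -E => /npair_inj[/prf_code_inj-> ]; case: col' col F2 {E} => -[].
    by exists c1 => [|e col E]; [apply: below_refl; case: b1 | case: N; exists e, col].
  exists c2; split; first exact: below_trans b10.
  split=> //; first exact: below_trans b1.
  have lx : x < stem c1 by case: (wf_part b1.1 px).
  by exists x; have [_ [l2 E2 _]] := b2; rewrite E2 //; split=> //; lia.
have mono m n : m <= n -> below (f n) (f m).
  move=> /subnK <-; elim: (n - m) => [|k IH]; first by apply: below_refl; case: (Hf m).1.
  by rewrite addSn; apply: below_trans IH; case: (Hf (k + m)).2.
have stem_ge n : n <= stem (f n).
  elim: n => // n IH; have [_ [_ [x [le lt _]] _]] := Hf n; lia.
pose H x := part (f x.+1) i x.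
have HE n x : x < stem (f n) -> H x = part (f n) i x.
  move=> lt; rewrite /H; have [le|le] := leqP x.+1 n.
    by have [_ [_ E _]] := mono _ _ le; rewrite E //; apply: stem_ge.
  by have [_ [_ E _]] := mono _ _ (ltnW le); rewrite E.
have L n : limit (f n) i H.
  move=> m; exists (f (maxn n m)); split.
  - by apply: mono; lia.
  - by apply: leq_trans (stem_ge _); lia.
  - by move=> x lt; apply: HE; apply: leq_trans lt _; apply: leq_trans (stem_ge _); lia.
exists H; split=> [n|n|e col].
- have [_ [_ [x [le lt px]] _]] := Hf n; exists x; split.
    by apply: leq_trans (stem_ge n) le.
  by rewrite (HE n.+1).
- by move=> /(wf_part (Hf n.+1).1.1)[].
- by have [_ [_ _ F]] := Hf (npair (prf_code e) (nat_of_bool col)); apply: F.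
Qed.

(* When side i can no longer grow, its output is replaced by one that appears
   exactly when the side grows, so that the dichotomy is decided on the other side. *)
Lemma stuck_forces c0 i : wf B c0 ->
  (forall c x, below c c0 -> stem c0 <= x -> ~~ part c i x) ->
  forall c e col, below c c0 -> exists2 c', below c' c & forces c' e (~~ i) col.
Proof.
move=> W0 stuck c e col bc; apply: contrapT => N0.
have N c' : below c' c -> ~ forces c' e (~~ i) col by move=> b F; apply: N0; exists c'.
have [c1 [s [b1 ps js]]] := solves_prints_long 1 bc.1 (N c (below_refl bc.1)).
pose grown u (Y : nat -> bool) (_ : nat) := exb u (fun x => (stem c0 <= x) && Y x).
have adm_grown : admissible grown.
  split; first by rewrite /grown; computable.
  by move=> u u' Y Y' s' le YY; apply: exb_mono => // x lt; rewrite YY.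
pose out i' := if i' == i then grown else fun u Y s => run u Y (prf_code e) s 1.
have adm i' : admissible (out i') by rewrite /out; case: eqP => _ //; apply: admissible_run.
pose b := nth false s 0 (+) col.
have [c2 [i' [W2 E2 K]]] := @key B c1 out (fun=> col) 0 b b1.1 adm.
have b20 : below c2 c0 by apply: below_trans bc; apply: below_trans b1.
case: (eqVneq i' i) => Ei; last first.
  have Ei' : i' = ~~ i by case: i' i Ei {out adm K adm_grown stuck N0 N ps} => -[].
  apply: (N c2); first by apply: below_trans b1.
  rewrite -Ei'; apply: (key_forces (a := fun=> col) (s := s)) K => //; first exact: b1.1.
  - by rewrite /out (negbTE Ei).
  - by rewrite Ei'.
  - by rewrite /b addbK.
subst i'; case: K => [[s' [u [_]]]|[n Av]].
  by rewrite /out eqxx => /exbP[x _ /andP[le]]; rewrite (negbTE (stuck _ _ b20 le)).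
have [Y [RK RD Rg]] := wf_reservoir W2.
have [x /andP[le _] Yx] := Rg (stem c2) (leqnn _).
pose E x := if x < stem c1 then part c1 i x else Y x.
(* Any string with the first bit of [s] and a code above [n] would do, since [grown] prints all
   codes at once. *)
pose t := nth false s 0 :: nseq n true.
have lt : n < code t by have := size_code t; rewrite /= size_nseq.
have [l2 _ _] := E2; have [_ [l0 _ _]] := b20.
have /negP : ~~ exb x.+1 (fun y => (stem c0 <= y) && E y).
  have := Av Y E RK _ _ x.+1 (code t) lt; rewrite bitat_code /b addbK /out eqxx.
  by apply=> // y ly; rewrite /E ?ly // ltnNge ly.
by apply; apply/exbP; exists x => //; rewrite /E ltnNge (leq_trans l2 le) Yx andbT; lia.
Qed.

Definition initial := Condition (fun _ _ => false) 0 (fun _ _ => true) succn.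

Lemma wf_initial : wf B initial.
Proof.
split=> //=; first by split=> //; computable.
  by computable.
by exists (fun=> true); split=> // m _; exists m => //; rewrite leqnn /=.
Qed.

(** Three cases. If some side is stuck below a condition, the other side works there. If side false
    can always force its requirements, it works. Otherwise some pair [e], [col] cannot be forced on
    side false below some [c0], and there [disjunction] forces every requirement on side true. *)
Lemma generic_exists : exists H i,
  [/\ infinite_set H, forall n, H n -> B n = i & forall e col, ~ solves e H col].
Proof.
have [[c0 [i [b0 stuck]]]|grow] := pselect (exists c0 i, below c0 initial /\
    forall c x, below c c0 -> stem c0 <= x -> ~~ part c i x).
  have [||H HH] := @generic_set c0 (~~ i) b0.1.
  - move=> c bc; have [x [c' [bc' le px]]] := add_element bc.1.
    have [_ [l0 _ _]] := bc.
    exists x, c'; split=> //; case: (eqVneq (B x) i) px => [->|ne].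
      by rewrite (negbTE (stuck _ _ (below_trans bc' bc) _)) //; lia.
    by rewrite (_ : ~~ i = B x) //; case: (B x) ne; case: (i).
  - exact: stuck_forces b0.1 stuck.
  - by exists H, (~~ i).
have {}grow c i : below c initial -> exists x c', [/\ below c' c, stem c <= x & part c' i x].
  move=> b; apply: contrapT => N; apply: grow; exists c, i; split=> // c' x b' le.
  by apply/negP => px; apply: N; exists x, c'.
have W := wf_initial.
have [all|nall] := pselect (forall c e col, below c initial ->
    exists2 c', below c' c & forces c' e false col).
  have [||H HH] := @generic_set initial false W; last by exists H, false.
    by move=> c; apply: grow.
  exact: all.
have [c0 [e [col [b0 N]]]] : exists c0 e col, below c0 initial /\
    forall c', below c' c0 -> ~ forces c' e false col.
  apply: contrapT => N; apply: nall => c e col b; apply: contrapT => N'; apply: N.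
  by exists c, e, col; split=> // c' b' F; apply: N'; exists c'.
have [||H HH] := @generic_set c0 true b0.1; last by exists H, true.
  by move=> c b; apply: grow; apply: below_trans b0.
move=> c e' col' b; have [c' b' [[] F]] := @disjunction c (fun i => if i then e' else e)
  (fun i => if i then col' else col) b.1; first by exists c'.
by case: (N c' (below_trans b' b)).
Qed.
End Generic.

(* The partition A_0 ∪ A_1 = 2^{<ω} is given by A : seq bool -> bool with
   A_i = {σ | A σ = (i == 1)}; likewise B_i = {n | B n = (i == 1)}. *)
Theorem mainTheorem2 :
  exists A : seq bool -> bool,
    Delta02 A /\
    forall B : nat -> bool,
      exists H : nat -> bool,
        infinite_set H /\
        ((forall n, H n -> B n = false) \/ (forall n, H n -> B n = true)) /\
        ~ (exists S : seq bool -> bool,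
             computes H S /\ iso_full_tree S /\
             ((forall s, S s -> A s = false) \/ (forall s, S s -> A s = true))).
Proof.
exists (fun s => lim_colour (code s)); split=> [|B]; first exact: delta02_lim_colour.
have [H [i [inf HB NS]]] := generic_exists B.
exists H; split=> //; split; first by case: i HB; [right | left].
move=> [S [[e SH] [iso Scol]]].
by case: Scol => col; [apply: (NS e false) | apply: (NS e true)]; exists S.
Qed.
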